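(* Let $(\mathcal D,\mathcal I,i^\star)$ be an identification task with $K$ Gaussian arms, where arm $k$ has a known variance $\sigma_k^2>0$ (possibly different for each arm). Suppose that there is an $L^2$ ball $B(\eta,r)$ with center $\eta\in\mathrm{cl}(\mathcal D)$ and radius $r>0$ such that $i^\star$ takes only two values in $B(\eta,r)$ (on $B(\eta,r)\cap\mathcal D$), say $i$ and $j$, and the boundary between $B(\eta,r)\cap\{\mu: i^\star(\mu)=i\}$ and $B(\eta,r)\cap\{\mu:i^\star(\mu)=j\}$ is the restriction to $B(\eta,r)$ of a hyperplane passing through $\eta$. Then $$\inf_{\mathcal A\in\mathcal C_\infty}\ \sup_{\lambda\in\mathcal D}R_{H_{\mathcal C^{sp}},\infty}(\mathcal A,\lambda)\ge 1.$$
   Context: Setting (fixed budget bandit identification with Gaussian arms). There are $K\ge 1$ arms; arm $k\in[K]$ has distribution $\mathcal N(\mu_k,\sigma_k^2)$ with known $\sigma_k^2>0$ and unknown mean $\mu_k\in\mathbb R$. A bandit problem is identified with its mean vector $\mu\in\mathbb R^K$. For arm $k$, $\mathrm{KL}(x,y)=(x-y)^2/(2\sigma_k^2)$. An identification task $(\mathcal D,\mathcal I,i^\star)$ consists of a finite answer set $\mathcal I$, a set $\mathcal D\subseteq\mathbb R^K$, and a function $i^\star:\mathcal D\to\mathcal I$ such that, with $\mathcal D_i=\{\mu\in\mathcal D:i^\star(\mu)=i\}$, each $\mathcal D_i$ is open and equals the interior of its closure, and $\bigcup_i\mathrm{cl}(\mathcal D_i)=\mathbb R^K$. $i^\star$ is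 extended with arbitrary values in $\mathcal I$ to all of $\mathbb R^K$ (this extension only matters for the recommendation rule of static proportions algorithms). $\mathrm{Alt}(\mu)=\{\lambda\in\mathcal D:i^\star(\lambda)\ne i^\star(\mu)\}$. The geometric hypothesis of the claim means that $B(\eta,r)\cap\mathcal D_i$ and $B(\eta,r)\cap\mathcal D_j$, $i\neq j$, are the two parts of the ball strictly on either side of a hyperplane through $\eta$. An algorithm with horizon $T$: at each time $t=1,\dots,T$ it chooses an arm $k_t$ based on the previous observations and observes an independent sample from the distribution of arm $k_t$; after time $T$ it returns an answer $\hat i_T\in\mathcal I$ based on the observations. $N_{T,k}$ is the number of samples of arm $k$ up to time $T$ and $\hat\mu_{T,k}$ is their average. The error probability on problem $\mu$ is $p_{\mu,T}(\mathcal A)=\mathbb P_{\mu,\mathcal A}(\hat i_T\ne i^\star(\mu))$. An algorithm family is a sequence $\mathcal A=(\mathcal A_T)_{T\ge1}$ of algorithms, one for each horizon $T$; $\mathcal C_\infty$ is the class of all algorithm families. Let $h_{\mu,T}(\mathcal A)=T/\log(1/p_{\mu,T}(\mathcal A))\in[0,\infty]$ ($=0$ if $p_{\mu,T}=0$, $=\infty$ if $p_{\mu,T}=1$). The oracle difficulty of a class $\mathcal C$ is $H_{\mathcal C}(\mu)=\inf_{\mathcal A\in\mathcal C}\limsup_{T\to\infty}h_{\mu,T}(\mathcal A)$. Static proportions: let $\triangle_K^0=\{\omega\in\triangle_K:\omega_k>0\ \forall k\}$, with $\triangle_K$ the probability simplex. A static proportions algorithm family parametrized by $\omega\in\triangle_K^0$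 is one whose sampling rule satisfies $|N_{T,k}-T\omega_k|\le K$ for all $T$ and all $k\in[K]$, and which returns $\hat i_T=i^\star(\hat\mu_T)$. $\mathcal C^{sp}$ is the class of all of these, for all $\omega\in\triangle_K^0$; its oracle difficulty equals $H_{\mathcal C^{sp}}(\mu)=\big(\sup_{\omega\in\triangle_K^0}\inf_{\lambda\in\mathrm{Alt}(\mu)}\sum_{k}\omega_k\mathrm{KL}(\lambda_k,\mu_k)\big)^{-1}$. Difficulty ratio with respect to $H$: $R_{H,T}(\mathcal A,\mu)=h_{\mu,T}(\mathcal A)/H(\mu)$ and $R_{H,\infty}(\mathcal A,\mu)=\limsup_{T\to\infty}R_{H,T}(\mathcal A,\mu)$. *)

(* Defs.v *)
From HB Require Import structures.
From mathcomp Require Import all_boot all_order all_algebra.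
From mathcomp Require Import all_classical all_reals all_analysis.

Set Implicit Arguments.
Unset Strict Implicit.
Unset Printing Implicit Defensive.

Import Order.TTheory GRing.Theory Num.Theory.
Import numFieldNormedType.Exports.

Local Open Scope classical_set_scope.
Local Open Scope ring_scope.

(** Identification tasks. A bandit problem with [K] arms is identified with its
    mean vector in ['rV[R]_K]. *)

Definition answer_cell (R : realType) (K : nat) (I : finType)
    (D : set 'rV[R]_K) (istar : 'rV[R]_K -> I) (i : I) : set 'rV[R]_K :=
  [set mu | D mu /\ istar mu = i].

(** [istar] is total: outside [D] it is the arbitrary extension used by static
    proportions algorithms. The extension has to be Borel for the event "the
    recommendation is wrong" to have a probability (on [D] this is automatic,
    the cells being open). *)
Record is_identification_task (R : realType) (K : nat) (I : finType)
    (D : set 'rV[R]_K) (istar : 'rV[R]_K -> I) : Prop := {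
  cell_open : forall i, open (answer_cell D istar i) ;
  cell_regular : forall i,
    answer_cell D istar i = interior (closure (answer_cell D istar i)) ;
  cell_cover : \bigcup_i closure (answer_cell D istar i) = [set: 'rV[R]_K] ;
  istar_borel : forall i, <<s open >> [set mu | istar mu = i] }.

(** The topology of ['rV[R]_K] is that of the sup norm (which is also the one
    used by the library's [ball]), whence this separate Euclidean ball. *)
Definition l2ball (R : realType) (K : nat) (eta : 'rV[R]_K) (r : R) :
    set 'rV[R]_K :=
  [set x | Num.sqrt (\sum_k (x 0 k - eta 0 k) ^+ 2) < r].

(** [v] is a normal vector of the hyperplane through [eta]. *)
Definition two_answers_hyperplane (R : realType) (K : nat) (I : finType)
    (D : set 'rV[R]_K) (istar : 'rV[R]_K -> I) (eta : 'rV[R]_K) (r : R)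
    (i j : I) : Prop :=
  l2ball eta r `&` D `<=` [set mu | istar mu = i \/ istar mu = j] /\
  exists2 v : 'rV[R]_K, v != 0 &
    l2ball eta r `&` answer_cell D istar i =
      l2ball eta r `&` [set x | \sum_k v 0 k * (x 0 k - eta 0 k) < 0] /\
    l2ball eta r `&` answer_cell D istar j =
      l2ball eta r `&` [set x | 0 < \sum_k v 0 k * (x 0 k - eta 0 k)].

(** Algorithm with horizon [T]. The argument [w : Omega] is the algorithm's
    internal randomness, drawn before the interaction ([Omega := unit] gives
    the deterministic algorithms). A history is the sequence of the rewards
    observed so far: given [w], it determines the arms that were pulled. *)
Record algorithm d (Omega : measurableType d) (R : realType) (K : nat)
    (I : finType) (T : nat) := Algorithm {
  sampling : Omega -> seq R -> 'I_K ;
  recommendation : Omega -> seq R -> I ;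
  sampling_measurable : forall t k, (t < T)%N ->
    measurable [set z : Omega * t.-tuple R | sampling z.1 z.2 = k] ;
  recommendation_measurable : forall i,
    measurable [set z : Omega * T.-tuple R | recommendation z.1 z.2 = i] }.

(** Families are also indexed by [T = 0]; this is invisible in a limsup. *)
Definition algorithm_family d (Omega : measurableType d) (R : realType)
    (K : nat) (I : finType) : Type :=
  forall T, algorithm Omega R K I T.

Definition all_families d (Omega : measurableType d) (R : realType)
    (K : nat) (I : finType) : set (algorithm_family Omega R K I) := setT.

Section interaction.
Context d (Omega : measurableType d) (R : realType) (K : nat) (I : finType).
Context (P : probability Omega R).
Context (sigma : 'I_K -> R) (istar : 'rV[R]_K -> I).

(** Expectation of [f] at the final history, when [n] more rounds are played
    after the history [h] with sampling rule [arm] on the problem [mu]: the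
    next reward has law [N(mu_k, sigma_k^2)] given [h], where [k := arm h]
    ([normal_prob] takes the standard deviation). *)
Fixpoint expect_play (mu : 'rV[R]_K) (arm : seq R -> 'I_K)
    (f : seq R -> \bar R) (n : nat) (h : seq R) : \bar R :=
  if n is n'.+1 then
    (\int[normal_prob (mu 0%R (arm h)) (sigma (arm h))]_x
       expect_play mu arm f n' (rcons h x))%E
  else f h.

Definition error_prob (mu : 'rV[R]_K) (T : nat) (A : algorithm Omega R K I T) :
    \bar R :=
  (\int[P]_w expect_play mu (sampling A w)
     (fun h => (recommendation A w h != istar mu)%:R%:E) T [::])%E.

(** With the conventions of [\bar R] ([0^-1 = +oo], [lne +oo = +oo] and
    [+oo^-1 = 0]), this is [0] if the error probability is [0] and [+oo] if it
    is [1] and [T > 0]. *)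
Definition hardness (mu : 'rV[R]_K) (T : nat) (A : algorithm Omega R K I T) :
    \bar R :=
  (T%:R%:E / lne (1 / error_prob mu A))%E.

Definition oracle_difficulty (C : set (algorithm_family Omega R K I))
    (mu : 'rV[R]_K) : \bar R :=
  ereal_inf [set limn_esup (fun T => hardness mu (A T)) | A in C].

Definition difficulty_ratio (H : 'rV[R]_K -> \bar R)
    (A : algorithm_family Omega R K I) (mu : 'rV[R]_K) : \bar R :=
  limn_esup (fun T => hardness mu (A T) / H mu)%E.

Definition num_pulls (T : nat) (A : algorithm Omega R K I T) (w : Omega)
    (h : seq R) (k : 'I_K) : nat :=
  \sum_(t < T) (sampling A w (take t h) == k).

(** The average of an empty sample is [0]. *)
Definition empirical_mean (T : nat) (A : algorithm Omega R K I T) (w : Omega)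
    (h : seq R) : 'rV[R]_K :=
  \row_k ((\sum_(t < T | sampling A w (take t h) == k) h`_t)
          / (num_pulls A w h k)%:R).

Definition open_simplex : set ('I_K -> R) :=
  [set omega | (forall k, 0 < omega k) /\ \sum_k omega k = 1].

Definition static_proportions (omega : 'I_K -> R) :
    set (algorithm_family Omega R K I) :=
  [set A | forall T, (0 < T)%N -> forall (w : Omega) (h : T.-tuple R),
    (forall k, `|(num_pulls (A T) w h k)%:R - T%:R * omega k| <= K%:R) /\
    recommendation (A T) w h = istar (empirical_mean (A T) w h)].

Definition static_families : set (algorithm_family Omega R K I) :=
  \bigcup_(omega in open_simplex) static_proportions omega.

End interaction.

(* Main.v *)
Require Import Defs.
From HB Require Import structures.
From mathcomp Require Import all_boot all_order all_algebra.
From mathcomp Require Import all_classical all_reals all_analysis.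
From mathcomp Require Import measurable_realfun ring lra.

Set Implicit Arguments.
Unset Strict Implicit.
Unset Printing Implicit Defensive.

Import Order.TTheory GRing.Theory Num.Theory.
Import numFieldNormedType.Exports.

Local Open Scope classical_set_scope.
Local Open Scope ring_scope.

(** Take [lam = eta +/- delta * sigma_k * sgn v_k], on the two sides of the
    hyperplane. Both problems lie [delta] standard deviations away from [eta] in
    every coordinate, so that each observation, of whichever arm, carries the
    same information [delta ^ 2 / 2] about the change from [eta] to [lam]. On
    [eta] any algorithm misses one of the two answers with probability at least
    [1 / 2], hence (Hoelder) its error on one of the two problems is at least
    [exp (- T (delta ^ 2 / 2 + o(1)))]. Conversely, static proportions close to
    [|v_k| sigma_k / \sum_l |v_l| sigma_l] achieve that exponent on both
    problems: for small [delta], crossing the hyperplane is the likeliest error,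
    of probability at most [exp (- T delta ^ 2 / 2)] by Chernoff's bound. *)

(** Monotonicity holds without measurability: the integral of a nonnegative function is a supremum
    over the simple functions below it. *)
Lemma ge0_le_integralT d (T : measurableType d) (R : realType)
    (mu : {measure set T -> \bar R}) (f g : T -> \bar R) :
  (forall x, 0 <= f x)%E -> (forall x, f x <= g x)%E ->
  (\int[mu]_x f x <= \int[mu]_x g x)%E.
Proof.
move=> f0 fg; have g0 x : (0 <= g x)%E := le_trans (f0 x) (fg x).
rewrite !ge0_integralTE//; apply: ereal_sup_le => _ [h hf <-].
by exists h => // x; exact: le_trans (hf x) (fg x).
Qed.

Lemma prob_ge0_integral_le1 d (T : measurableType d) (R : realType)
    (P : probability T R) (f : T -> \bar R) :
  (forall x, 0 <= f x <= 1)%E -> (\int[P]_x f x <= 1)%E.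
Proof.
move=> f01; have /le_trans : (\int[P]_x f x <= \int[P]_x (cst 1 x))%E.
  by apply: ge0_le_integralT => x; have /andP[] := f01 x.
apply; rewrite integral_cst// mul1e. exact: sprobability_setT.
Qed.

(** * Gaussian integrals and exponential tilting *)

Section gaussian_integrals.
Context (R : realType).
Implicit Types (m s a : R) (f : R -> \bar R).

(** [normal_pdf] and the Radon-Nikodym derivative have the same integral over every measurable set,
    hence agree almost everywhere. *)
Lemma ge0_integral_normal_prob m s f : (forall x, 0 <= f x)%E ->
  measurable_fun setT f ->
  (\int[normal_prob m s]_x f x =
   \int[lebesgue_measure]_x (f x * (normal_pdf m s x)%:E))%E.
Proof.
move=> f0 mf; have dom := normal_prob_dominates m s.
have mpdf : measurable_fun setT (fun x => (normal_pdf m s x)%:E).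
  by apply/measurable_EFinP; exact: measurable_normal_pdf.
pose g := Radon_Nikodym_SigmaFinite.f (normal_prob m s) lebesgue_measure.
have ig : lebesgue_measure.-integrable setT g.
  exact: Radon_Nikodym_SigmaFinite.f_integrable.
rewrite -(Radon_Nikodym_SigmaFinite.change_of_variables dom)//.
apply: ae_eq_integral => //.
- by apply: emeasurable_funM => //; exact: measurable_int ig.
- exact: emeasurable_funM.
- apply: ae_eqe_mul2l; apply: integral_ae_eq => //.
  move=> A _ mA.
  by rewrite -Radon_Nikodym_SigmaFinite.f_integral.
Qed.

(** Completing the square. With the shift of the mean written [a * s ^+ 2], the log-likelihood ratio
    is affine in [x] with slope [a]. *)
Lemma normal_pdf_tilt m s a x : s != 0 ->
  normal_pdf (m + a * s ^+ 2) s x =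
  expR (a * x - a * m - a ^+ 2 * s ^+ 2 / 2) * normal_pdf m s x.
Proof.
move=> s0; rewrite !normal_pdfE// /normal_fun.
have -> : - (x - (m + a * s ^+ 2)) ^+ 2 / (s ^+ 2 *+ 2) =
    (a * x - a * m - a ^+ 2 * s ^+ 2 / 2) + - (x - m) ^+ 2 / (s ^+ 2 *+ 2).
  by field.
by rewrite expRD; ring.
Qed.

Lemma ge0_integral_normal_tilt m s a f : s != 0 -> (forall x, 0 <= f x)%E ->
  measurable_fun setT f ->
  (\int[normal_prob (m + a * s ^+ 2) s]_x f x =
   \int[normal_prob m s]_x
     (f x * (expR (a * x - a * m - a ^+ 2 * s ^+ 2 / 2))%:E))%E.
Proof.
move=> s0 f0 mf; have me : measurable_fun setT
    (fun x => (expR (a * x - a * m - a ^+ 2 * s ^+ 2 / 2))%:E).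
  apply/measurable_EFinP; apply: measurableT_comp => //.
  apply: measurable_funB => //; apply: measurable_funB => //.
rewrite !ge0_integral_normal_prob//; last 2 first.
- by move=> x; rewrite mule_ge0// lee_fin expR_ge0.
- exact: emeasurable_funM.
by apply: eq_integral => x _; rewrite normal_pdf_tilt// EFinM muleA.
Qed.

(** The tilted density still has mass [1]; its normalizing factor is the moment generating
    function. *)
Lemma integral_normal_expR m s a : s != 0 ->
  (\int[normal_prob m s]_x (expR (a * x))%:E =
   (expR (a * m + a ^+ 2 * s ^+ 2 / 2))%:E)%E.
Proof.
move=> s0.
have E : (\int[normal_prob m s]_x
    (expR (a * x - a * m - a ^+ 2 * s ^+ 2 / 2))%:E = 1)%E.
  transitivity (\int[normal_prob (m + a * s ^+ 2) s]_x (cst 1 x))%E.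
    rewrite (@ge0_integral_normal_tilt m s a)//.
    by apply: eq_integral => x _; rewrite mul1e.
  by rewrite integral_cst// mul1e; exact: probability_setT.
transitivity (\int[normal_prob m s]_x
    ((expR (a * m + a ^+ 2 * s ^+ 2 / 2))%:E *
     (expR (a * x - a * m - a ^+ 2 * s ^+ 2 / 2))%:E))%E.
  by apply: eq_integral => x _; rewrite -EFinM -expRD; congr (expR _)%:E; ring.
rewrite ge0_integralZl ?E ?mule1// ?lee_fin ?expR_ge0//.
by apply/measurable_EFinP; apply: measurableT_comp => //;
  apply: measurable_funB => //; apply: measurable_funB.
Qed.

End gaussian_integrals.

(** * Hoelder's inequality with integer powers *)

Section hoelder_power.
Context (R : realType).

(* The graph of [u |-> u ^+ n.+1] lies above its tangent line at [t]. *)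
Lemma expr_tangent (n : nat) (u t : R) : 0 <= u -> 0 <= t ->
  n.+1%:R * t ^+ n * u <= u ^+ n.+1 + n%:R * t ^+ n.+1.
Proof.
move=> u0 t0; elim: n => [|n IH]; first by rewrite expr0 expr1 mul0r addr0; lra.
(* Multiply the induction hypothesis by [u] and add [n.+1 * t ^ n * (u - t) ^ 2 >= 0]. *)
have := ler_wpM2r u0 IH; have := mulr_ge0 (exprn_ge0 n t0) (sqr_ge0 (u - t)).
move=> /(mulr_ge0 (ler0n R n.+1)).
rewrite !exprS -!natr1; move: (t ^+ n) (u ^+ n) (n%:R : R) => x y z.
by nra.
Qed.

(* Hoelder's inequality with conjugate exponents [n.+1] and [n.+1 / n]:
   integrate the tangent inequality at [t = c * e x] and optimize over [c]. *)
Lemma hoelder_expr d (T : measurableType d) (nu : {measure set T -> \bar R})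
    (n : nat) (f e : T -> R) (Z : R) :
  0 < Z -> measurable_fun setT f -> measurable_fun setT e ->
  (forall x, 0 <= f x) -> (forall x, 0 <= e x) ->
  (\int[nu]_x (e x ^+ n.+1)%:E <= Z%:E)%E ->
  ((\int[nu]_x (f x * e x ^+ n)%:E) ^+ n.+1 <=
   (Z ^+ n)%:E * \int[nu]_x (f x ^+ n.+1)%:E)%E.
Proof.
move=> Z0 mf me f0 e0 eZ.
set a := (\int[nu]_x _)%E; set b := (\int[nu]_x (f x ^+ n.+1)%:E)%E.
have a0 : (0 <= a)%E.
  by apply: integral_ge0 => x _; rewrite lee_fin mulr_ge0// exprn_ge0.
have b0 : (0 <= b)%E by apply: integral_ge0 => x _; rewrite lee_fin exprn_ge0.
have mfe k l (g h : T -> R) : measurable_fun setT g -> measurable_fun setT h ->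
    measurable_fun setT (fun x => (k * (g x ^+ l * h x))%:E).
  move=> mg mh; apply/measurable_EFinP; apply: measurable_funM => //.
  by apply: measurable_funM => //; exact: measurable_funX.
have mfX l (g : T -> R) : measurable_fun setT g ->
    measurable_fun setT (fun x => (g x ^+ l)%:E).
  by move=> mg; apply/measurable_EFinP; exact: measurable_funX.
have key c : 0 <= c ->
    ((n.+1%:R * c ^+ n)%:E * a <= b + (n%:R * c ^+ n.+1 * Z)%:E)%E.
  move=> c0; rewrite EFinM.
  apply: (@le_trans _ _ (b + (n%:R * c ^+ n.+1)%:E *
      \int[nu]_x (e x ^+ n.+1)%:E)%E); last first.
    rewrite leeD2l// [in leRHS]EFinM lee_wpmul2l// lee_fin mulr_ge0//.
    exact: exprn_ge0.
  rewrite -EFinM -!ge0_integralZl ?lee_fin ?mulr_ge0 ?exprn_ge0//; first last.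
  - by move=> x _; rewrite lee_fin mulr_ge0// exprn_ge0.
  - by apply/measurable_EFinP; apply: measurable_funM => //; exact: measurable_funX.
  - by move=> x _; rewrite lee_fin exprn_ge0.
  - exact: mfX.
  rewrite -ge0_integralD//; first last.
  - by apply: measurable_funeM; exact: mfX.
  - by move=> x _; rewrite -EFinM lee_fin mulr_ge0 ?exprn_ge0 ?mulr_ge0 ?exprn_ge0.
  - exact: mfX.
  - by move=> x _; rewrite lee_fin exprn_ge0.
  apply: ge0_le_integralT => x.
    by rewrite -EFinM lee_fin !(mulr_ge0, exprn_ge0).
  rewrite -!EFinM -EFinD lee_fin.
  have := expr_tangent n (f0 x) (mulr_ge0 c0 (e0 x)).
  by rewrite !exprMn; lra.
(* An infinite [b] makes the bound trivial; otherwise [key] at [c = 1] shows that [a] is finite. *)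
have [->|bfin] := eqVneq b +oo%E.
  by rewrite gt0_muley ?leey// lte_fin exprn_gt0.
have {}bfin : b \is a fin_num by rewrite ge0_fin_numE// ltey.
have afin : a \is a fin_num.
  have := key 1 ler01; rewrite !expr1n !mulr1 -(fineK bfin) -EFinD.
  rewrite ge0_fin_numE//; case: a a0 {key} => // [r|] _ ; first by rewrite ltry.
  by rewrite gt0_muley ?lte_fin ?ltr0n.
clearbody a b; case: a afin a0 key => // a _; rewrite lee_fin => a0 key.
case: b bfin b0 key => // b _ _ key.
rewrite -EFin_expe -EFinM lee_fin.
(* The choice [c = a / Z] maximizes [n.+1 * c ^ n * a - n * c ^ n.+1 * Z]. *)
have /key : 0 <= a / Z by rewrite divr_ge0// ltW.
rewrite -!EFinM -EFinD lee_fin !expr_div_n.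
have E : n.+1%:R * (a ^+ n / Z ^+ n) * a =
    a ^+ n.+1 / Z ^+ n + n%:R * (a ^+ n.+1 / Z ^+ n.+1) * Z.
  by rewrite !exprS -natr1; field; rewrite ?expf_neq0 ?gt_eqF.
by rewrite E lerD2r ler_pdivrMr ?exprn_gt0// mulrC.
Qed.

End hoelder_power.

(** * Measurability of the interaction *)

Lemma measurable_fun_finite_cases d d' (T : measurableType d)
    (U : measurableType d') (J : finType) (c : T -> J) (g : J -> T -> U) :
  (forall j, measurable [set x | c x = j]) ->
  (forall j, measurable_fun setT (g j)) ->
  measurable_fun setT (fun x => g (c x) x).
Proof.
move=> mc mg _ Y mY; rewrite setTI.
have -> : (fun x => g (c x) x) @^-1` Y =
    \bigcup_(j in [set: J]) ([set x | c x = j] `&` g j @^-1` Y).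
  apply/seteqP; split=> [x Yx|x [j _ [/= <- //]]].
  by exists (c x).
apply: fin_bigcup_measurable => // j _; apply: measurableI => //.
by rewrite -[X in measurable X]setTI; exact: mg.
Qed.

Lemma measurable_rcons d1 d2 (T1 : measurableType d1) (T2 : measurableType d2)
    n (f : T1 -> n.-tuple T2) (g : T1 -> T2) :
  measurable_fun setT f -> measurable_fun setT g ->
  measurable_fun setT (fun x => [tuple of rcons (f x) (g x)]).
Proof.
move=> mf mg; apply/measurable_fun_tnthP => i.
have [ltin|lein] := ltnP i n.
  rewrite (_ : _ \o _ = (@tnth _ T2 ^~ (Ordinal ltin)) \o f).
    by apply: measurableT_comp => //; exact: measurable_tnth.
  apply/funext => x /=; rewrite (tnth_nth (g x)) [RHS](tnth_nth (g x))/=.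
  by rewrite nth_rcons size_tuple ltin.
rewrite (_ : _ \o _ = g)//; apply/funext => x /=.
have -> : i = ord_max by apply/val_inj/eqP; rewrite eqn_leq -ltnS ltn_ord lein.
by rewrite (tnth_nth (g x))/= nth_rcons size_tuple ltnn eqxx.
Qed.

Section play.
Context (R : realType) (K : nat) (sigma : 'I_K -> R).
Implicit Types (mu : 'rV[R]_K) (arm : seq R -> 'I_K) (h : seq R).

Local Notation E_ := (expect_play sigma).

Lemma expect_play_ge0 mu arm f n h :
  (forall h, 0 <= f h)%E -> (0 <= E_ mu arm f n h)%E.
Proof.
by move=> f0; elim: n h => //= n IH h; apply: integral_ge0 => x _; exact: IH.
Qed.

Lemma expect_play_le1 mu arm f n h :
  (forall h, 0 <= f h <= 1)%E -> (E_ mu arm f n h <= 1)%E.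
Proof.
move=> f01; elim: n h => /= [h|n IH h]; first by have /andP[] := f01 h.
apply: prob_ge0_integral_le1 => x; rewrite IH andbT.
by apply: expect_play_ge0 => h'; have /andP[] := f01 h'.
Qed.

Section measurability.
Context d (Omega : measurableType d) (T : nat).
Context (arm : Omega -> seq R -> 'I_K) (f : Omega -> seq R -> \bar R).
Hypothesis marm : forall t k, (t < T)%N ->
  measurable [set z : Omega * t.-tuple R | arm z.1 z.2 = k].
Hypothesis f0 : forall w h, (0 <= f w h)%E.
Hypothesis mf : measurable_fun setT (fun z : Omega * T.-tuple R => f z.1 z.2).

(** Induction on the number of rounds left: the next reward is integrated out by Tonelli's theorem.
    Measurability is joint in the randomness and the history, because the arm depends on both. *)
Lemma measurable_expect_play mu n t : (n + t = T)%N ->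
  measurable_fun setT
    (fun z : Omega * t.-tuple R => E_ mu (arm z.1) (f z.1) n z.2).
Proof.
elim: n t => [t /= tT|n IH t ntT]; first by move: mf; rewrite -tT.
have /IH mG : (n + t.+1 = T)%N by rewrite addnS.
pose G (z : (Omega * t.-tuple R) * R) :=
  E_ mu (arm z.1.1) (f z.1.1) n (rcons z.1.2 z.2).
have {}mG : measurable_fun setT G.
  rewrite (_ : G = (fun z : Omega * t.+1.-tuple R =>
    E_ mu (arm z.1) (f z.1) n z.2) \o
    (fun z : (Omega * t.-tuple R) * R =>
      (z.1.1, [tuple of rcons z.1.2 z.2])))//.
  apply: measurableT_comp => //; apply: measurable_fun_pair => /=.
    exact: measurableT_comp.
  by apply: measurable_rcons => //; exact: measurableT_comp.
have G0 z : (0 <= G z)%E by apply: expect_play_ge0.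
(* Freezing the arm [k] in [g] makes the measure of integration independent of [z], as Tonelli's
   theorem requires; the finitely many arms are then glued. *)
pose c (z : Omega * t.-tuple R) := arm z.1 z.2.
pose g k z := (\int[normal_prob (mu 0%R k) (sigma k)]_x G (z, x))%E.
rewrite (_ : (fun z => _) = (fun z => g (c z) z))//.
apply: measurable_fun_finite_cases => k.
- by apply: marm; rewrite -ntT addSn ltnS leq_addl.
- exact: (@measurable_fun_fubini_tonelli_F _ _ _ _ _ (normal_prob _ _)).
Qed.

Lemma measurable_expect_play_next mu n w h : (n + (size h).+1 = T)%N ->
  measurable_fun setT (fun x => E_ mu (arm w) (f w) n (rcons h x)).
Proof.
move=> nhT; have := measurable_expect_play mu nhT.
move=> m; apply: (measurableT_comp m
  (g := fun x : R => (w, [tuple of rcons (in_tuple h) x]))).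
by apply: measurable_fun_pair => //; exact: measurable_rcons.
Qed.

Lemma measurable_expect_play0 mu :
  measurable_fun setT (fun w => E_ mu (arm w) (f w) T [::]).
Proof.
have /(measurable_expect_play mu) : (T + 0 = T)%N by rewrite addn0.
move=> m; apply: (measurableT_comp m (g := fun w => (w, [tuple]))).
exact: measurable_fun_pair.
Qed.

End measurability.

End play.

(** * Change of problem along a play *)

Section change_of_problem.
Context (R : realType) (K : nat) (sigma : 'I_K -> R).
Context d (Omega : measurableType d) (T : nat).
Context (arm : Omega -> seq R -> 'I_K).
Hypothesis marm : forall t k, (t < T)%N ->
  measurable [set z : Omega * t.-tuple R | arm z.1 z.2 = k].
Hypothesis sigma_gt0 : forall k, 0 < sigma k.

Local Notation E_ := (expect_play sigma).
Local Notation ind b := (fun h => (b h)%:R%:E).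

Lemma ind_ge0 (b : seq R -> bool) h : (0 <= ((b h)%:R : R)%:E)%E.
Proof. by rewrite lee_fin. Qed.

Lemma ind_ge0_le1 (b : seq R -> bool) h : (0 <= ((b h)%:R : R)%:E <= 1)%E.
Proof. by rewrite !lee_fin; case: (b h); rewrite ?ler01 ?lexx. Qed.

Lemma expect_play_ind_ge0_le1 mu a (b : seq R -> bool) n h :
  (0 <= E_ mu a (ind b) n h <= 1)%E.
Proof.
apply/andP; split; first exact/expect_play_ge0/ind_ge0.
exact/expect_play_le1/ind_ge0_le1.
Qed.

Lemma expect_play_ind_fin mu a (b : seq R -> bool) n h :
  E_ mu a (ind b) n h \is a fin_num.
Proof.
have /andP[E0 E1] := expect_play_ind_ge0_le1 mu a b n h.
by rewrite ge0_fin_numE// (le_lt_trans E1)// ltry.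
Qed.

Let mind (b : Omega -> seq R -> bool) := measurable_fun setT
  (fun z : Omega * T.-tuple R => ((b z.1 z.2)%:R : R)%:E).

Let m_next b mu n w h : mind b -> (n + (size h).+1 = T)%N ->
  measurable_fun setT (fun x => E_ mu (arm w) (ind (b w)) n (rcons h x)).
Proof.
by move=> mb; exact: (@measurable_expect_play_next _ _ sigma _ _ _ _ (fun w => ind (b w))
  marm (fun w h => ind_ge0 (b w) h) mb).
Qed.

Let m_play b mu : mind b -> measurable_fun setT
  (fun w => E_ mu (arm w) (ind (b w)) T [::]).
Proof.
by move=> mb; exact: (@measurable_expect_play0 _ _ sigma _ _ _ _ (fun w => ind (b w))
  marm (fun w h => ind_ge0 (b w) h) mb).
Qed.

Section one_event.
Context (b : Omega -> seq R -> bool).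
Hypothesis mb : measurable_fun setT
  (fun z : Omega * T.-tuple R => ((b z.1 z.2)%:R : R)%:E).

(* The gaps are all worth [delta] standard deviations, so that one more
   observation costs the same factor whichever arm is pulled. *)
Lemma expect_play_change (mu nu : 'rV[R]_K) (delta : R) (n : nat) :
  (0 < n)%N -> (forall k, (mu 0 k - nu 0 k) ^+ 2 = (delta * sigma k) ^+ 2) ->
  forall N w h, (N + size h = T)%N ->
  (E_ mu (arm w) (ind (b w)) N h ^+ n.+1 <=
   (expR (n.+1%:R / n%:R * delta ^+ 2 / 2) ^+ N)%:E *
   E_ nu (arm w) (ind (b w)) N h)%E.
Proof.
move=> n0 gap; set C := expR _; elim=> [w h _|N IH w h NhT].
  by rewrite expr0 mul1e -EFin_expe lee_fin; case: (b w h); rewrite ?expr1n ?expr0n.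
have nn0 : n%:R != 0 :> R by rewrite pnatr_eq0 -lt0n.
have {}NhT : (N + (size h).+1 = T)%N by rewrite -NhT addnS.
rewrite /=; set k := arm w h; set s := sigma k.
have s0 : s != 0 by rewrite gt_eqF ?sigma_gt0.
set F := fun x => E_ mu (arm w) (ind (b w)) N (rcons h x).
set G := fun x => E_ nu (arm w) (ind (b w)) N (rcons h x).
have F0 x : (0 <= F x)%E by apply/expect_play_ge0/ind_ge0.
have G0 x : (0 <= G x)%E by apply/expect_play_ge0/ind_ge0.
have Ffin x : F x \is a fin_num by exact: expect_play_ind_fin.
have mF : measurable_fun setT F by exact: m_next.
have mG : measurable_fun setT G by exact: m_next.
(* The slope of the log-likelihood ratio of arm [k] between [mu] and [nu]. *)
pose a := (mu 0 k - nu 0 k) / s ^+ 2.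
have muE : mu 0 k = nu 0 k + a * s ^+ 2 by rewrite /a; field.
have a2 : a ^+ 2 * s ^+ 2 = delta ^+ 2.
  by rewrite /a expr_div_n gap -/s; field.
pose c := - a * nu 0 k - a ^+ 2 * s ^+ 2 / 2.
(* [e x ^+ n] is the likelihood ratio of [mu] to [nu] at the reward [x]. *)
pose e x := expR ((a * x + c) / n%:R).
have me : measurable_fun setT e.
  apply: measurableT_comp => //; apply: measurable_funM => //.
  by apply: measurable_funD => //.
(* The moment of order [p = n.+1 / n] of the likelihood ratio under [nu]: it is
   [exp (p (p - 1) delta ^ 2 / 2)], and [p - 1 = 1 / n]. *)
pose Z := expR (n.+1%:R / n%:R * delta ^+ 2 / 2 / n%:R).
have ZC : Z ^+ n = C.
  by rewrite /Z /C -expRM_natl; congr expR; field.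
have eZ : (\int[normal_prob (nu 0%R k) s]_x (e x ^+ n.+1)%:E <= Z%:E)%E.
  under eq_integral => x _.
    rewrite (_ : e x ^+ n.+1 =
      expR (n.+1%:R / n%:R * c) * expR (n.+1%:R / n%:R * a * x)); last first.
      by rewrite /e -expRM_natl -expRD; congr expR; field.
    rewrite EFinM; over.
  rewrite ge0_integralZl ?lee_fin ?expR_ge0//; last first.
    by apply/measurable_EFinP; exact: measurableT_comp.
  rewrite integral_normal_expR// -EFinM -expRD lee_fin ler_expR.
  rewrite -a2 /c -!natr1 le_eqVlt; apply/orP; left; apply/eqP.
  by field.
have -> : (\int[normal_prob (mu 0%R k) s]_x F x =
    \int[normal_prob (nu 0%R k) s]_x (fine (F x) * e x ^+ n)%:E)%E.
  rewrite muE ge0_integral_normal_tilt//; apply: eq_integral => x _.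
  rewrite EFinM fineK//; congr (_ * (_)%:E)%E.
  by rewrite /e -expRM_natl; congr expR; rewrite /c; field.
have mfF : measurable_fun setT (fine \o F) by exact: measurableT_comp.
(* Hoelder's inequality pays the factor [Z ^+ n = C] for this round; the induction hypothesis, under
   the integral, pays for the others. *)
apply: (@le_trans _ _ (C%:E *
    \int[normal_prob (nu 0%R k) s]_x (fine (F x) ^+ n.+1)%:E)%E).
  rewrite -ZC; apply: hoelder_expr => //.
  - exact: expR_gt0.
  - by move=> x; exact: fine_ge0.
  - by move=> x; exact: expR_ge0.
rewrite exprS EFinM -muleA lee_wpmul2l ?lee_fin ?expR_ge0//.
rewrite -ge0_integralZl ?lee_fin ?exprn_ge0 ?expR_ge0//; last first.
  by move=> x _; exact: G0.
apply: ge0_le_integralT => x; first by rewrite lee_fin exprn_ge0// fine_ge0.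
rewrite EFin_expe fineK//; apply: IH.
by rewrite size_rcons.
Qed.

Context (P : probability Omega R).
Local Notation Pr mu :=
  (\int[P]_w expect_play sigma mu (arm w) (ind (b w)) T [::])%E.

(** The law of the internal randomness is the same on both problems, so averaging over it costs no
    factor: Hoelder's inequality is applied with [e = 1], as a form of Jensen's. *)
Lemma prob_play_change (mu nu : 'rV[R]_K) (delta : R) (n : nat) :
  (0 < n)%N -> (forall k, (mu 0 k - nu 0 k) ^+ 2 = (delta * sigma k) ^+ 2) ->
  (Pr mu ^+ n.+1 <= (expR (n.+1%:R / n%:R * delta ^+ 2 / 2) ^+ T)%:E * Pr nu)%E.
Proof.
move=> n0 gap.
pose F w := E_ mu (arm w) (ind (b w)) T [::].
have F0 w : (0 <= F w)%E by apply/expect_play_ge0/ind_ge0.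
have Ffin w : F w \is a fin_num by exact: expect_play_ind_fin.
have mfF : measurable_fun setT (fine \o F).
  by apply: measurableT_comp => //; exact: m_play.
have -> : Pr mu = (\int[P]_w (fine (F w) * cst 1 w ^+ n)%:E)%E.
  by apply: eq_integral => w _; rewrite expr1n mulr1 fineK.
apply: (@le_trans _ _ ((1 ^+ n)%:E * \int[P]_w (fine (F w) ^+ n.+1)%:E)%E).
  apply: hoelder_expr => //; first by move=> w; exact: fine_ge0.
  under eq_integral do rewrite expr1n.
  by apply: prob_ge0_integral_le1 => w; rewrite lee01 lexx.
rewrite expr1n mul1e -ge0_integralZl ?lee_fin ?exprn_ge0 ?expR_ge0//; first last.
- by move=> w _; exact/expect_play_ge0/ind_ge0.
- exact: m_play.
apply: ge0_le_integralT => w; first by rewrite lee_fin exprn_ge0// fine_ge0.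
rewrite EFin_expe fineK//; apply: (expect_play_change n0 gap).
by rewrite addn0.
Qed.

End one_event.

(** A union bound by backward induction: the two indicators add up to at least [1] on every final
    history, and averaging over rewards and randomness preserves this. *)
Lemma prob_play_cover (P : probability Omega R) (b1 b2 : Omega -> seq R -> bool)
    (mu : 'rV[R]_K) :
  measurable_fun setT
    (fun z : Omega * T.-tuple R => ((b1 z.1 z.2)%:R : R)%:E) ->
  measurable_fun setT
    (fun z : Omega * T.-tuple R => ((b2 z.1 z.2)%:R : R)%:E) ->
  (forall w h, b1 w h || b2 w h) ->
  (1 <= \int[P]_w E_ mu (arm w) (ind (b1 w)) T [::] +
        \int[P]_w E_ mu (arm w) (ind (b2 w)) T [::])%E.
Proof.
move=> mb1 mb2 b12.
have key N w h : (N + size h = T)%N ->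
    (1 <= E_ mu (arm w) (ind (b1 w)) N h + E_ mu (arm w) (ind (b2 w)) N h)%E.
  elim: N h => [h _|N IH h NhT] /=.
    by rewrite -EFinD lee_fin; case: (b1 w h) (b2 w h) (b12 w h) => [] [] //= _; lra.
  have {}NhT : (N + (size h).+1 = T)%N by rewrite -NhT addnS.
  rewrite -ge0_integralD//; first last.
  - exact: m_next.
  - by move=> x _; exact/expect_play_ge0/ind_ge0.
  - exact: m_next.
  - by move=> x _; exact/expect_play_ge0/ind_ge0.
  rewrite -(probability_setT (normal_prob (mu 0 (arm w h)) (sigma (arm w h)))).
  rewrite -[leLHS]mul1e -integral_cst//; apply: ge0_le_integralT => x //=.
  by apply: IH; rewrite size_rcons.
rewrite -ge0_integralD//; first last.
- exact: m_play.
- by move=> x _; exact/expect_play_ge0/ind_ge0.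
- exact: m_play.
- by move=> x _; exact/expect_play_ge0/ind_ge0.
rewrite -(probability_setT P) -[leLHS]mul1e -integral_cst//.
by apply: ge0_le_integralT => w //=; apply: key; rewrite addn0.
Qed.

End change_of_problem.

(** * Lower bound on the error for one of two problems *)

Section error_lower_bound.
Context (R : realType) (K : nat) (sigma : 'I_K -> R) (I : finType).
Context d (Omega : measurableType d) (P : probability Omega R) (T : nat).
Context (istar : 'rV[R]_K -> I) (A : algorithm Omega R K I T).
Hypothesis sigma_gt0 : forall k, 0 < sigma k.

Lemma measurable_wrong_answer i : measurable_fun setT
  (fun z : Omega * T.-tuple R => ((recommendation A z.1 z.2 != i)%:R : R)%:E).
Proof.
apply: (measurable_fun_finite_cases (c := fun z : Omega * T.-tuple R =>
  recommendation A z.1 z.2) (g := fun j _ => ((j != i)%:R : R)%:E)) => // j.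
exact: recommendation_measurable.
Qed.

Lemma error_prob_ge0 mu : (0 <= error_prob P sigma istar mu A)%E.
Proof. by apply: integral_ge0 => w _; exact/expect_play_ge0/ind_ge0. Qed.

Lemma error_prob_le1 mu : (error_prob P sigma istar mu A <= 1)%E.
Proof.
by apply: prob_ge0_integral_le1 => w; exact: expect_play_ind_ge0_le1.
Qed.

(* Whatever the algorithm does on [eta], it misses one of the two answers with
   probability at least [1 / 2] there. *)
Lemma error_prob_lower (eta mu nu : 'rV[R]_K) (delta : R) (n : nat) :
  (0 < n)%N -> istar mu != istar nu ->
  (forall k, (eta 0 k - mu 0 k) ^+ 2 = (delta * sigma k) ^+ 2) ->
  (forall k, (eta 0 k - nu 0 k) ^+ 2 = (delta * sigma k) ^+ 2) ->
  let p := expR (- (n.+1%:R / n%:R * delta ^+ 2 / 2 * T%:R + n.+1%:R * ln 2)) in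
  (p%:E <= error_prob P sigma istar mu A)%E \/
  (p%:E <= error_prob P sigma istar nu A)%E.
Proof.
move=> n0 munu gmu gnu p.
set C := n.+1%:R / n%:R * delta ^+ 2 / 2 in p *.
pose Q i := (\int[P]_w expect_play sigma eta (sampling A w)
  (fun h => ((recommendation A w h != i)%:R)%:E) T [::])%E.
(* The change of problem gives [(1 / 2) ^ n.+1 <= exp (C T) * error]; solving for the error yields
   [p]. *)
have lower (lam : 'rV[R]_K) :
    (forall k, (eta 0 k - lam 0 k) ^+ 2 = (delta * sigma k) ^+ 2) ->
    ((2^-1 : R)%:E <= Q (istar lam))%E ->
    (p%:E <= error_prob P sigma istar lam A)%E.
  move=> glam half.
  have := prob_play_change (b := fun w h => recommendation A w h != istar lam)
    (sampling_measurable A) sigma_gt0 (measurable_wrong_answer _) P n0 glam.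
  rewrite -/(Q (istar lam)) -/C => h.
  have Qfin : Q (istar lam) \is a fin_num.
    rewrite ge0_fin_numE; last first.
      by apply: integral_ge0 => w _; exact/expect_play_ge0/ind_ge0.
    apply: le_lt_trans (ltry 1); apply: prob_ge0_integral_le1 => w.
    exact: expect_play_ind_ge0_le1.
  have efin : error_prob P sigma istar lam A \is a fin_num.
    by rewrite ge0_fin_numE ?error_prob_ge0// (le_lt_trans (error_prob_le1 _))// ltry.
  move: h half; rewrite -[X in (_ <= _ * X)%E]/(error_prob P sigma istar lam A).
  rewrite -(fineK Qfin) -(fineK efin) -EFin_expe -EFinM !lee_fin.
  move: (fine _) (fine _) => e q qe half.
  have {}qe : 2^-1 ^+ n.+1 <= expR C ^+ T * e.
    by apply: le_trans qe; rewrite ler_pXn2r// nnegrE; lra.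
  rewrite /p expRN expRD [expR (C * _)]expRM_natr expRM_natl lnK ?posrE//.
  by rewrite invfM mulrC ler_pdivrMr ?exprn_gt0 ?expR_gt0// -exprVn mulrC.
have : (1 <= Q (istar mu) + Q (istar nu))%E.
  apply: (@prob_play_cover _ _ sigma _ _ _ _ (sampling_measurable A) P
    (fun w h => recommendation A w h != istar mu)
    (fun w h => recommendation A w h != istar nu)) => [||w h];
    try exact: measurable_wrong_answer.
  (* No recommendation equals both answers, so every history misses one of them. *)
  by rewrite -negb_and; apply: contra munu => /andP[/eqP <- /eqP <-].
have [/(lower _ gmu)|mlt] := leP (2^-1 : R)%:E (Q (istar mu)); first by left.
have [/(lower _ gnu)|nlt] := leP (2^-1 : R)%:E (Q (istar nu)); first by right.
rewrite leNgt => /negP[]; apply: (lt_le_trans (lteD mlt nlt)).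
by rewrite -EFinD lee_fin; lra.
Qed.

End error_lower_bound.

(** * From error probabilities to hardness *)

Section hardness_bounds.
Context (R : realType) (K : nat) (sigma : 'I_K -> R) (I : finType).
Context d (Omega : measurableType d) (P : probability Omega R) (T : nat).
Context (istar : 'rV[R]_K -> I) (A : algorithm Omega R K I T).

Local Notation err mu := (error_prob P sigma istar mu A).

Let lne_err_ge0 mu : (0 <= lne (1 / err mu))%E.
Proof.
by rewrite lne_ge0 mul1e inve_ge1 ?error_prob_le1 ?error_prob_ge0.
Qed.

Lemma hardness_ge0 mu : (0 <= hardness P sigma istar mu A)%E.
Proof. by rewrite mule_ge0 ?lee_fin ?ler0n// inve_ge0. Qed.

Lemma hardness_le mu (x : R) : 0 < x -> (err mu <= (expR (- x))%:E)%E ->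
  (hardness P sigma istar mu A <= (T%:R / x)%:E)%E.
Proof.
move=> x0 errx; rewrite EFinM lee_wpmul2l ?lee_fin ?ler0n//.
have -> : x^-1%:E = (x%:E^-1)%E by rewrite inver gt_eqF.
rewrite lee_pV2 ?inE// ?lee_fin ?(ltW x0)//.
have -> : x%:E = lne (expR x)%:E by rewrite lne_EFin ?expR_gt0 ?expRK.
rewrite lee_lne ?in_itv/= ?leey ?andbT ?lee_fin ?expR_ge0//.
  rewrite mul1e inve_pge ?inE ?error_prob_ge0 ?lee_fin ?expR_ge0//.
  by rewrite inver gt_eqF ?expR_gt0// -expRN.
by rewrite mul1e inve_ge0 error_prob_ge0.
Qed.

Lemma hardness_ge mu (x : R) : 0 < x -> ((expR (- x))%:E <= err mu)%E ->
  ((T%:R / x)%:E <= hardness P sigma istar mu A)%E.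
Proof.
move=> x0 errx; rewrite EFinM lee_wpmul2l ?lee_fin ?ler0n//.
have -> : x^-1%:E = (x%:E^-1)%E by rewrite inver gt_eqF.
rewrite lee_pV2 ?inE// ?lee_fin ?(ltW x0)//.
have -> : x%:E = lne (expR x)%:E by rewrite lne_EFin ?expR_gt0 ?expRK.
rewrite lee_lne ?in_itv/= ?leey ?andbT ?lee_fin ?expR_ge0//.
  rewrite mul1e inve_ple ?inE ?error_prob_ge0 ?lee_fin ?expR_ge0//.
  by rewrite inver gt_eqF ?expR_gt0// -expRN.
by rewrite mul1e inve_ge0 error_prob_ge0.
Qed.

End hardness_bounds.

(** * Borel sets of mean vectors *)

Section borel_row.
Context (R : realType) (K : nat).

(** An open set is a countable union of boxes with rational centers and radii [1 / n.+1], and the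
    preimage of a box is a finite intersection of coordinate preimages. *)
Lemma open_preimage_row_measurable d (X : measurableType d) (F : X -> 'rV[R]_K)
    (U : set 'rV[R]_K) :
  (forall k, measurable_fun setT (fun x => F x 0 k)) ->
  open U -> measurable (F @^-1` U).
Proof.
move=> mF oU.
pose q2 (q : {ffun 'I_K -> rat}) : 'rV[R]_K := \row_k ratr (q k).
pose box (c : {ffun 'I_K -> rat} * nat) : set 'rV[R]_K :=
  ball (q2 c.1) c.2.+1%:R^-1.
have -> : U = \bigcup_(c in [set c | box c `<=` U]) box c.
  apply/seteqP; split=> [u Uu|u [c cU]]; last exact: cU.
  have /nbhs_ballP[e /= e0 eU] := open_nbhs_nbhs (conj oU Uu).
  (* A box of radius below [e / 2] whose center is within that radius of [u] contains [u] and stays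
     in the ball of radius [e]. *)
  have e20 : 0 < e / 2 by rewrite divr_gt0.
  have [n _ /(_ n (leqnn n)) nlt] := near_infty_natSinv_lt (PosNum e20).
  have [i [i0 ilt iE]] : exists i : R, [/\ 0 < i, i < e / 2 & n.+1%:R^-1 = i].
    by exists n.+1%:R^-1; rewrite invr_gt0.
  have qP k : exists q : rat, `|ratr q - u 0 k| < i.
    have /rat_in_itvoo[q] : u 0 k - i < u 0 k + i by lra.
    rewrite in_itv/= => /andP[? ?]; exists q.
    by rewrite ltr_norml; apply/andP; split; lra.
  pose q := [ffun k => sval (cid (qP k))].
  have qu k : `|ratr (q k) - u 0 k| < i.
    by rewrite ffunE; exact: (svalP (cid (qP k))).
  exists (q, n); rewrite /box /= iE.
    move=> y [_ yq]; apply: eU; split=> // a k; rewrite (ord1 a).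
    have := yq 0 k; rewrite /q2 mxE /ball/= => h.
    have := qu k; move: h ilt; rewrite !ltr_norml.
    by move=> /andP[? ?] ? /andP[? ?]; apply/andP; split; lra.
  by split=> // a k; rewrite (ord1 a) /q2 mxE; exact: qu.
rewrite preimage_bigcup bigcup_mkcond.
apply: countable_bigcupT_measurable => [|c]; first exact: countableP.
case: ifP => // _.
rewrite /box; have [i [i0 ->]] : exists i : R, 0 < i /\ c.2.+1%:R^-1 = i.
  by exists c.2.+1%:R^-1; rewrite invr_gt0.
have -> : F @^-1` ball (q2 c.1) i = \bigcap_(k in [set: 'I_K])
    (fun x => F x 0 k) @^-1` [set` `]ratr (c.1 k) - i, ratr (c.1 k) + i[].
  apply/seteqP; split=> [x [_ h] k _ /=|x h].
    have := h 0 k; rewrite /q2 mxE /ball/= in_itv/= ltr_norml.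
    by move=> /andP[? ?]; apply/andP; split; lra.
  split; first by [].
  move=> a k; rewrite (ord1 a) /q2 mxE /ball/=.
  have := h k Logic.I; rewrite /= in_itv/= ltr_norml.
  by move=> /andP[? ?]; apply/andP; split; lra.
apply: fin_bigcap_measurable => // k _.
by rewrite -[X in measurable X]setTI; apply: mF => //; exact: measurable_itv.
Qed.

(** The sets with measurable preimage form a sigma-algebra that contains the open sets. *)
Lemma borel_preimage_row_measurable d (X : measurableType d)
    (F : X -> 'rV[R]_K) (B : set 'rV[R]_K) :
  (forall k, measurable_fun setT (fun x => F x 0 k)) ->
  <<s open >> B -> measurable (F @^-1` B).
Proof.
move=> mF; apply: (@smallest_sub _ _ _ [set B | measurable (F @^-1` B)]).
  split=> /=.
  - by rewrite preimage_set0.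
  - by move=> C mC; rewrite setTD preimage_setC; exact: measurableC.
  - by move=> C mC; rewrite preimage_bigcup; exact: bigcupT_measurable.
by move=> U oU; exact: open_preimage_row_measurable.
Qed.

End borel_row.

(** * Static proportions realized by a fixed schedule *)

Lemma sum_nth_count (V : nmodType) (J : finType) (j0 : J) (s : seq J)
    (phi : J -> V) :
  \sum_(t < size s) phi (nth j0 s t) = \sum_j phi j *+ count_mem j s.
Proof.
rewrite -(big_mkord xpredT (fun t => phi (nth j0 s t))) -(big_nth j0 xpredT).
elim: s => [|x s IH]; first by rewrite big_nil big1.
rewrite big_cons IH /=; under [RHS]eq_bigr do rewrite mulrnDr.
rewrite big_split/=; congr (_ + _).
rewrite (bigD1 x)//= eqxx big1 ?addr0// => j /negPf.
by rewrite eq_sym => ->.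
Qed.

(** Round every [T * omega k] down, except at [k0], which absorbs the remainder: each other arm
    gives up less than one pull, so [k0] gains at most [K]. *)
Lemma exists_allocation (R : realType) (K T : nat) (k0 : 'I_K)
    (omega : 'I_K -> R) : open_simplex omega ->
  exists2 s : seq 'I_K, size s = T &
    forall k, `|(count_mem k s)%:R - T%:R * omega k| <= K%:R.
Proof.
move=> [w0 w1]; pose m k := Num.truncn (T%:R * omega k).
have mP k : (m k)%:R <= T%:R * omega k < (m k).+1%:R.
  by apply: truncn_itv; rewrite mulr_ge0 ?ler0n// ltW.
pose M := (\sum_(k | k != k0) m k)%N.
have wE : T%:R * omega k0 = T%:R - \sum_(k | k != k0) T%:R * omega k.
  by rewrite -[X in X - _]mulr1 -w1 (bigD1 k0)//= mulrDr mulr_sumr addrK.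
have lo : (M%:R : R) <= \sum_(k | k != k0) T%:R * omega k.
  by rewrite natr_sum; apply: ler_sum => k _; have /andP[] := mP k.
have hi : \sum_(k | k != k0) T%:R * omega k <= (M%:R : R) + K%:R.
  have -> : K%:R = \sum_(k < K) 1 :> R by rewrite sumr_const card_ord.
  rewrite [X in _ + X](bigD1 k0)//= /M natr_sum addrCA -big_split/=.
  apply: ler_wpDl => //; apply: ler_sum => k _.
  by have /andP[_ /ltW] := mP k; rewrite -natr1.
(* This keeps the natural number subtraction [T - M] from being truncated. *)
have MT : (M <= T)%N.
  rewrite -(ler_nat R); apply: le_trans lo _.
  have := mulr_ge0 (ler0n R T) (ltW (w0 k0)); rewrite wE; lra.
pose N k := if k == k0 then (T - M)%N else m k.
exists (flatten [seq nseq (N k) k | k <- enum 'I_K]).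
  rewrite size_flatten /shape -map_comp sumnE big_map big_enum/= (bigD1 k0)//=.
  rewrite size_nseq /N eqxx -[RHS](subnK MT); congr addn.
  by apply: eq_bigr => k /negPf kk0; rewrite size_nseq kk0.
move=> k; rewrite count_flatten -map_comp sumnE big_map big_enum/= (bigD1 k)//=.
rewrite count_nseq/= eqxx mul1n big1 ?addn0; last first.
  by move=> j /negPf jk; rewrite count_nseq/= jk.
have K1 : 1 <= K%:R :> R by rewrite ler1n (leq_trans _ (ltn_ord k0)).
rewrite /N; case: eqVneq => [->|_].
  rewrite wE natrB// ler_norml; apply/andP; split; lra.
have := mP k; rewrite -natr1 => /andP[? ?].
by rewrite ler_norml; apply/andP; split; lra.
Qed.

Section schedule.
Context (R : realType) (K : nat) (I : finType) (istar : 'rV[R]_K -> I).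
Context d (Omega : measurableType d) (T : nat) (k0 : 'I_K) (s : seq 'I_K).
Hypothesis istar_borel : forall i, <<s open >> [set mu | istar mu = i].

(** The counts are read off the schedule instead of the history, which makes the mean linear in the
    rewards. *)
Definition schedule_mean (h : seq R) : 'rV[R]_K :=
  \row_k ((\sum_(t < T | nth k0 s t == k) h`_t) / (count_mem k s)%:R).

Lemma schedule_sampling_measurable t k : (t < T)%N ->
  measurable [set z : Omega * t.-tuple R | nth k0 s (size z.2) = k].
Proof.
move=> _; have [<-|neq] := eqVneq (nth k0 s t) k.
  rewrite (_ : mkset _ = setT)//; apply/seteqP; split=> // z _ /=.
  by rewrite size_tuple.
rewrite (_ : mkset _ = set0)//; apply/seteqP; split=> // z /=.
by rewrite size_tuple; exact/eqP.
Qed.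

Lemma schedule_recommendation_measurable i :
  measurable [set z : Omega * T.-tuple R | istar (schedule_mean z.2) = i].
Proof.
apply: (borel_preimage_row_measurable (F := fun z : Omega * T.-tuple R =>
  schedule_mean z.2) _ (istar_borel i)) => k.
rewrite (_ : (fun _ => _) = fun z : Omega * T.-tuple R =>
  (\sum_(t < T | nth k0 s t == k) tnth z.2 t) / (count_mem k s)%:R); last first.
  apply/funext => z; rewrite mxE; congr (_ / _).
  by apply: eq_bigr => t _; rewrite (tnth_nth (0 : R)).
apply: measurable_funM => //.
rewrite (_ : (fun _ => _) = fun z : Omega * T.-tuple R =>
  \sum_(t < T) if nth k0 s t == k then tnth z.2 t else 0); last first.
  by apply/funext => z; rewrite big_mkcond.
apply: measurable_sum => t; case: (nth k0 s t == k) => //.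
by apply: (measurableT_comp (measurable_tnth t)).
Qed.

Definition schedule_algorithm : algorithm Omega R K I T :=
  Algorithm (sampling := fun _ h => nth k0 s (size h))
    (recommendation := fun _ h => istar (schedule_mean h))
    schedule_sampling_measurable schedule_recommendation_measurable.

Hypothesis sT : size s = T.

Lemma schedule_num_pulls w (h : T.-tuple R) k :
  num_pulls schedule_algorithm w h k = count_mem k s.
Proof.
transitivity (\sum_(t < size s) (nth k0 s t == k : nat)).
  rewrite /num_pulls sT; apply: eq_bigr => t _ /=.
  by rewrite size_takel// size_tuple ltnW.
rewrite (sum_nth_count k0 s (fun j => (j == k) : nat)) (bigD1 k)//= eqxx.
rewrite big1 ?addr0; last by move=> j /negPf ->; rewrite mul0rn.
by rewrite natn.
Qed.

Lemma schedule_empirical_mean w (h : T.-tuple R) :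
  empirical_mean schedule_algorithm w h = schedule_mean h.
Proof.
apply/rowP => k; rewrite !mxE schedule_num_pulls; congr (_ / _).
by apply: eq_bigl => t /=; rewrite size_takel// size_tuple ltnW.
Qed.

End schedule.

(** * Chernoff bounds for a fixed schedule *)

Section chernoff.
Context (R : realType) (K : nat) (sigma : 'I_K -> R).
Context (k0 : 'I_K) (s : seq 'I_K) (J : finType).
Context (alpha : J -> 'I_K -> R) (c : J -> R) (lam : 'rV[R]_K).
Hypothesis sigma_gt0 : forall k, 0 < sigma k.

(** The cumulant generating function of arm [k] on the problem [lam], at [alpha j k]. *)
Let kappa j k := alpha j k * lam 0 k + alpha j k ^+ 2 * sigma k ^+ 2 / 2.

(** Backward induction: the schedule fixes the arm of each round, so integrating out a reward
    replaces its term in the exponent by its cumulant [kappa]. *)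
Lemma expect_play_chernoff (f : seq R -> \bar R) :
  (forall h, 0 <= f h)%E ->
  (forall h, size h = size s ->
    f h <= \sum_j (expR (c j +
      \sum_(t < size s) alpha j (nth k0 s t) * h`_t))%:E)%E ->
  (expect_play sigma lam (fun h => nth k0 s (size h)) f (size s) [::] <=
   \sum_j (expR (c j + \sum_(t < size s) kappa j (nth k0 s t)))%:E)%E.
Proof.
move=> f0 fle.
have key N h : (N + size h = size s)%N ->
  (expect_play sigma lam (fun h => nth k0 s (size h)) f N h <=
   \sum_j (expR (c j + \sum_(0 <= t < size h) alpha j (nth k0 s t) * h`_t +
     \sum_(size h <= t < size s) kappa j (nth k0 s t)))%:E)%E.
  elim: N h => [h hT|N IH h NhT].
    rewrite add0n in hT; apply: (le_trans (fle h hT)).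
    rewrite le_eqVlt; apply/orP; left; apply/eqP; apply: eq_bigr => j _.
    by rewrite (big_geq (m := size h)) ?hT// addr0 big_mkord.
  rewrite /=; set k := nth k0 s (size h).
  have sh : (size h < size s)%N by rewrite -NhT addSn ltnS leq_addl.
  (* The exponent without the contribution of the coming round. *)
  pose B j := c j + \sum_(0 <= t < size h) alpha j (nth k0 s t) * h`_t +
    \sum_((size h).+1 <= t < size s) kappa j (nth k0 s t).
  apply: (@le_trans _ _ (\int[normal_prob (lam 0%R k) (sigma k)]_x
      \sum_j ((expR (B j))%:E * (expR (alpha j k * x))%:E))%E).
    apply: ge0_le_integralT => x; first exact: expect_play_ge0.
    apply: (le_trans (IH _ _)); first by rewrite size_rcons addnS -NhT addSn.
    rewrite le_eqVlt; apply/orP; left; apply/eqP; apply: eq_bigr => j _.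
    rewrite -EFinM -expRD size_rcons; congr (expR _)%:E.
    rewrite big_nat_recr//= nth_rcons ltnn eqxx -/k /B.
    rewrite (eq_big_nat _ _ (F2 := fun t => alpha j (nth k0 s t) * h`_t)); first by ring.
    by move=> t /andP[_ th]; rewrite nth_rcons th.
  have mexp j : measurable_fun [set: R] (fun x => (expR (alpha j k * x))%:E).
    by apply/measurable_EFinP; exact: measurableT_comp.
  rewrite ge0_integral_sum//; last first.
    by move=> j; apply: emeasurable_funM => //; exact: mexp.
  rewrite le_eqVlt; apply/orP; left; apply/eqP; apply: eq_bigr => j _.
  rewrite ge0_integralZl ?lee_fin ?expR_ge0//; last exact: mexp.
  rewrite integral_normal_expR ?gt_eqF// -EFinM -expRD; congr (expR _)%:E.
  by rewrite /B (big_ltn sh) -/k /kappa; ring.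
apply: (le_trans (key _ [::] (addn0 _))); rewrite le_eqVlt; apply/orP; left.
by apply/eqP; apply: eq_bigr => j _; rewrite big_geq// addr0 big_mkord.
Qed.

End chernoff.

(** * Error of a schedule whose correct region contains a polyhedron *)

Section static_error.
Context (R : realType) (K : nat) (sigma : 'I_K -> R) (I : finType).
Context (istar : 'rV[R]_K -> I) d (Omega : measurableType d).
Context (P : probability Omega R) (k0 : 'I_K) (s : seq 'I_K).
Hypothesis sigma_gt0 : forall k, 0 < sigma k.
Hypothesis istar_borel : forall i, <<s open >> [set mu | istar mu = i].
Hypothesis s_gt0 : forall k, (0 < count_mem k s)%N.

Local Notation mean := (schedule_mean (size s) k0 s).

Lemma schedule_mean_linear (b : 'I_K -> R) (h : seq R) :
  \sum_k b k * mean h 0 k =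
  \sum_(t < size s) b (nth k0 s t) / (count_mem (nth k0 s t) s)%:R * h`_t.
Proof.
rewrite [RHS](partition_big (fun t : 'I_(size s) => nth k0 s t) predT)//=.
apply: eq_bigr => k _; rewrite mxE mulrA mulrAC mulr_sumr.
by apply: eq_bigr => t /eqP <-.
Qed.

(** An error forces the empirical mean to violate one of the inequalities indexed by [J]. The
    exponential attached to that inequality is then at least [1], so the sum dominates the indicator
    of an error. *)
Lemma schedule_error_chernoff (J : finType) (b : J -> 'I_K -> R) (c : J -> R)
    (lam : 'rV[R]_K) :
  (forall mu : 'rV[R]_K, (forall j, c j + \sum_k b j k * mu 0 k < 0) ->
    istar mu = istar lam) ->
  (error_prob P sigma istar lam
     (schedule_algorithm Omega (size s) k0 s istar_borel) <=
   \sum_j (expR (c j + \sum_k (b j k * lam 0 k +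
     b j k ^+ 2 * sigma k ^+ 2 / (2 * (count_mem k s)%:R))))%:E)%E.
Proof.
move=> sep; pose n k : R := (count_mem k s)%:R.
have n0 k : n k != 0 by rewrite pnatr_eq0 -lt0n.
set M := (X in (_ <= X)%E).
have key w : (expect_play sigma lam
    (sampling (schedule_algorithm Omega (size s) k0 s istar_borel) w)
    (fun h => (recommendation (schedule_algorithm Omega (size s) k0 s
      istar_borel) w h != istar lam)%:R%:E) (size s) [::] <= M)%E.
  apply: le_trans (@expect_play_chernoff _ _ sigma k0 s J
    (fun j k => b j k / n k) c lam sigma_gt0 _ _ _) _ => [h|h _|] /=.
  - by rewrite lee_fin ler0n.
  - have [/sep ->|] := pselect (forall j, c j + \sum_k b j k * mean h 0 k < 0).
      by rewrite eqxx; apply: sume_ge0 => j _; rewrite lee_fin expR_ge0.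
    move=> /existsNP[j /negP]; rewrite -leNgt => j0.
    apply: (@le_trans _ _ 1%E); first by rewrite lee_fin; case: (_ != _).
    rewrite (bigD1 j)//= -[leLHS]adde0 leeD//; last first.
      by apply: sume_ge0 => j' _; rewrite lee_fin expR_ge0.
    by rewrite lee_fin -expR0 ler_expR -schedule_mean_linear.
  - rewrite le_eqVlt; apply/orP; left; apply/eqP; apply: eq_bigr => j _.
    (* Each pull of arm [k] has slope [b j k / n k]; over its [n k] pulls the quadratic terms add up
       with a single division by [n k]. *)
    rewrite (sum_nth_count k0 s (fun k =>
      b j k / n k * lam 0 k + (b j k / n k) ^+ 2 * sigma k ^+ 2 / 2)).
    congr (expR (_ + _))%:E; apply: eq_bigr => k _.
    by move: (n0 k); rewrite -mulr_natr /n => ?; field.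
have M0 : (0 <= M)%E by apply: sume_ge0 => j _; rewrite lee_fin expR_ge0.
apply: (@le_trans _ _ (\int[P]_w cst M w)%E).
  by apply: ge0_le_integralT => // w; exact/expect_play_ge0/ind_ge0.
by rewrite integral_cst// [X in (_ * X)%E](probability_setT P) mule1.
Qed.

End static_error.

(** * Boxes in Euclidean balls, and upper limits *)

Lemma l2ball_coord (R : realType) (K : nat) (eta x : 'rV[R]_K) (r : R) :
  (0 < K)%N -> 0 < r -> (forall k, `|x 0 k - eta 0 k| <= r / (2 * K%:R)) ->
  l2ball eta r x.
Proof.
move=> K0 r0 xr; rewrite /l2ball /=.
have K1 : 1 <= K%:R :> R by rewrite ler1n.
rewrite -[ltRHS]gtr0_norm// -[ltRHS]sqrtr_sqr ltr_sqrt ?exprn_gt0//.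
(* The squared distance is at most [K * (r / (2 K)) ^ 2 = r ^ 2 / (4 K)]. *)
apply: (@le_lt_trans _ _ (\sum_(k < K) (r / (2 * K%:R)) ^+ 2)).
  apply: ler_sum => k _; rewrite -real_normK ?num_real// ler_sqr ?nnegrE//.
  by rewrite (le_trans _ (xr k)).
rewrite sumr_const card_ord.
have -> : (r / (2 * K%:R)) ^+ 2 *+ K = r ^+ 2 / (4 * K%:R).
  by rewrite -[LHS]mulr_natr; field; rewrite gt_eqF// (lt_le_trans ltr01).
rewrite ltr_pdivrMr; last by lra.
by rewrite ltr_pMr ?exprn_gt0//; lra.
Qed.

Lemma limn_esup_le (R : realType) (u : (\bar R)^nat) (M : \bar R) (T0 : nat) :
  (forall T, (T0 <= T)%N -> u T <= M)%E -> (limn_esup u <= M)%E.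
Proof.
move=> uM; rewrite /limn_esup /limf_esup; apply: (@le_trans _ _
    (ereal_sup (u @` [set T | (T0 <= T)%N]))).
  by apply: ereal_inf_lbound; exists [set T | (T0 <= T)%N] => //; exists T0.
by apply: ge_ereal_sup => _ [T /= T0T <-]; exact: uM.
Qed.

Lemma limn_esup_lt (R : realType) (u : (\bar R)^nat) (c : \bar R) :
  (limn_esup u < c)%E -> exists T0, forall T, (T0 <= T)%N -> (u T < c)%E.
Proof.
rewrite /limn_esup /limf_esup => /ereal_inf_lt[_ [/= B [T0 _ TB] <-] supc].
exists T0 => T T0T; apply: le_lt_trans supc; apply: ereal_sup_ubound.
by exists T => //; exact: TB.
Qed.

Lemma nat_mul_ge (R : archiRealFieldType) (y x : R) : 0 < x ->
  exists T0, forall T, (T0 <= T)%N -> y <= T%:R * x.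
Proof.
move=> x0; exists (Num.bound `|y / x|) => T T0T.
rewrite -ler_pdivrMr//; apply: le_trans (ler_norm _) _; apply: ltW.
by apply: lt_le_trans (archi_boundP (normr_ge0 _)) _; rewrite ler_nat.
Qed.

(** * Static proportions on one side of the hyperplane *)

Section half_ball.
Context (R : realType) (K : nat) (sigma : 'I_K -> R) (I : finType).
Context (istar : 'rV[R]_K -> I) d (Omega : measurableType d).
Context (P : probability Omega R).
Hypothesis K_gt0 : (0 < K)%N.
Hypothesis sigma_gt0 : forall k, 0 < sigma k.
Hypothesis istar_borel : forall i, <<s open >> [set mu | istar mu = i].
Context (eta v : 'rV[R]_K) (r : R) (i : I).
Hypothesis r_gt0 : 0 < r.
Hypothesis v_neq0 : v != 0.
Hypothesis half_ball : forall x, l2ball eta r x ->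
  0 < \sum_k v 0 k * (x 0 k - eta 0 k) -> istar x = i.

(** [V] normalizes the proportions [|v_k| sigma_k], [S] bounds every [sigma k], and [rho] is the
    half-width of a box around [eta] inside the ball. *)
Let V := \sum_k `|v 0 k| * sigma k.
Let S := \sum_k sigma k.
Let rho := r / (2 * K%:R).

Let K_ge1 : 1 <= K%:R :> R. Proof. by rewrite ler1n. Qed.

Let rho_gt0 : 0 < rho. Proof. by rewrite divr_gt0// mulr_gt0// (lt_le_trans ltr01). Qed.

Let V_gt0 : 0 < V.
Proof.
have [k vk] : exists k, v 0 k != 0.
  apply/existsP; apply: contraNT v_neq0 => /existsPn v0; apply/eqP/rowP => k.
  by rewrite mxE; apply/eqP; have := v0 k; rewrite negbK.
rewrite /V (bigD1 k)//= ltr_pwDl ?mulr_gt0 ?normr_gt0//.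
by apply: sumr_ge0 => j _; rewrite mulr_ge0// ltW.
Qed.

Let sigma_le_S k : sigma k <= S.
Proof. by rewrite /S (bigD1 k)//= lerDl sumr_ge0// => j _; rewrite ltW. Qed.

Let S_gt0 : 0 < S.
Proof. by apply: lt_le_trans (sigma_gt0 (Ordinal K_gt0)) (sigma_le_S _). Qed.

(** [gam] is the mass put on the proportions [|v_k| sigma_k / V], and [beta] an additional share for
    each arm. The two smallness conditions keep [lam] in the box of half-width [rho / 2] and make
    leaving the box of half-width [rho] no likelier, in the Chernoff bounds, than crossing the
    hyperplane. *)
Context (lam : 'rV[R]_K) (delta gam beta : R).
Hypothesis delta_gt0 : 0 < delta.
Hypothesis lamE : forall k, `|lam 0 k - eta 0 k| = delta * sigma k.
Hypothesis lam_dir : \sum_k v 0 k * (lam 0 k - eta 0 k) = delta * V.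
Hypothesis gam01 : 0 < gam < 1.
Hypothesis beta_gt0 : 0 < beta.
Hypothesis delta_small1 : delta * S <= rho / 2.
Hypothesis delta_small2 : (2 * S * delta) ^+ 2 <= rho ^+ 2 * beta.

Lemma half_ball_lam : l2ball eta r lam.
Proof.
apply: l2ball_coord => // k; rewrite lamE -/rho.
apply: (le_trans (ler_wpM2l (ltW delta_gt0) (sigma_le_S k))).
by apply: (le_trans delta_small1); move: rho_gt0; lra.
Qed.

Lemma half_ball_istar : istar lam = i.
Proof. by apply: half_ball half_ball_lam _; rewrite lam_dir mulr_gt0. Qed.

Section one_schedule.
Context (s : seq 'I_K) (k0 : 'I_K).
Hypothesis s_gt0 : (0 < size s)%N.
Hypothesis s_count : forall k,
  (size s)%:R * (gam * (`|v 0 k| * sigma k / V) + beta) <= (count_mem k s)%:R.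

Let t : R := (size s)%:R.
Let t_gt0 : 0 < t. Proof. by rewrite ltr0n. Qed.

Let count_lower1 k : t * gam * (`|v 0 k| * sigma k) <= V * (count_mem k s)%:R.
Proof.
have := ler_wpM2l (ltW V_gt0) (s_count k); rewrite -/t; apply: le_trans.
have -> : V * (t * (gam * (`|v 0 k| * sigma k / V) + beta)) =
    t * gam * (`|v 0 k| * sigma k) + V * t * beta.
  by field; rewrite gt_eqF.
by rewrite lerDl !mulr_ge0// ltW.
Qed.

Let count_lower2 k : t * beta <= (count_mem k s)%:R.
Proof.
apply: le_trans (s_count k); rewrite -/t ler_pM2l// lerDr.
have /andP[/ltW g0 _] := gam01.
by rewrite !mulr_ge0 ?invr_ge0// ltW.
Qed.

Let count_gt0 k : (0 : R) < (count_mem k s)%:R.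
Proof. by apply: lt_le_trans (count_lower2 k); rewrite mulr_gt0. Qed.

(** [theta] minimizes [- theta delta V + theta ^ 2 V ^ 2 / (2 gam t)], and [tau] minimizes [- tau
    rho / 2 + tau ^ 2 S ^ 2 / (2 t beta)]. These are the upper bounds on the exponents found
    below. *)
Let theta := gam * t * delta / V.
Let tau := t * (rho * beta / (2 * S ^+ 2)).

Let theta_gt0 : 0 < theta.
Proof. by have /andP[? _] := gam01; rewrite /theta divr_gt0// !mulr_gt0. Qed.

Let tau_gt0 : 0 < tau.
Proof. by rewrite /tau mulr_gt0// divr_gt0// mulr_gt0// exprn_gt0. Qed.

(* [None] is the deviation across the hyperplane, [Some (l, b)] the deviation
   of coordinate [l] out of the box of half-width [rho]; [theta] and [tau] are
   the Chernoff parameters. *)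
Let slope (j : option ('I_K * bool)) (k : 'I_K) : R :=
  if j is Some (l, b) then if k == l then tau * (-1) ^+ b else 0
  else - (theta * v 0 k).
Let offset (j : option ('I_K * bool)) : R :=
  if j is Some (l, b) then - (tau * (-1) ^+ b * eta 0 l) - tau * rho
  else \sum_k theta * v 0 k * eta 0 k.

Let slope_sum l b (F : 'I_K -> R) :
  \sum_k slope (Some (l, b)) k * F k = tau * (-1) ^+ b * F l.
Proof.
by rewrite (bigD1 l)//= eqxx big1 ?addr0// => k /negPf ->; rewrite mul0r.
Qed.

(** The inequalities [Some (k, b)] confine [mu] to the box, hence to the ball, and [None] puts it on
    the side of [lam]. *)
Let separation (mu : 'rV[R]_K) :
  (forall j, offset j + \sum_k slope j k * mu 0 k < 0) -> istar mu = istar lam.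
Proof.
move=> h; rewrite half_ball_istar; apply: half_ball.
  apply: l2ball_coord => // k; rewrite -/rho ler_norml.
  have h1 := h (Some (k, false)); have h2 := h (Some (k, true)).
  rewrite !slope_sum/= expr0 expr1 in h1 h2.
  have {}h1 : tau * (mu 0 k - eta 0 k - rho) < 0 by move: h1; lra.
  have {}h2 : tau * (- (mu 0 k - eta 0 k) - rho) < 0 by move: h2; lra.
  by move: h1 h2; rewrite !pmulr_rlt0//; lra.
have := h None; rewrite /= -big_split/= => hN.
rewrite -(pmulr_rgt0 _ theta_gt0) mulr_sumr -oppr_lt0 -sumrN.
by apply: le_lt_trans hN; apply: ler_sum => k _; lra.
Qed.

Let exponent j := offset j + \sum_k (slope j k * lam 0 k +
  slope j k ^+ 2 * sigma k ^+ 2 / (2 * (count_mem k s)%:R)).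

Let exponent_hyperplane : exponent None <= - (gam * t * delta ^+ 2 / 2).
Proof.
have /andP[g0 _] := gam01.
rewrite /exponent big_split/= addrA -big_split/=.
have -> : \sum_k (theta * v 0 k * eta 0 k + - (theta * v 0 k) * lam 0 k) =
    - (theta * (delta * V)).
  rewrite -lam_dir mulr_sumr -sumrN; apply: eq_bigr => k _; ring.
(* By [count_lower1], the quadratic term of arm [k] is at most a constant multiple of
   [|v_k| sigma_k], so the sum gives back [V]. *)
apply: (@le_trans _ _ (- (theta * (delta * V)) +
    \sum_k theta ^+ 2 * V / (2 * (gam * t)) * (`|v 0 k| * sigma k))).
  rewrite lerD2l; apply: ler_sum => k _.
  have n0 := count_gt0 k; have lo := count_lower1 k.
  rewrite sqrrN exprMn -[v 0 k ^+ 2]real_normK ?num_real//.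
  have a0 : 0 <= `|v 0 k| * sigma k by rewrite mulr_ge0// ltW.
  rewrite ler_pdivrMr ?mulr_gt0//.
  have -> : theta ^+ 2 * `|v 0 k| ^+ 2 * sigma k ^+ 2 =
     theta ^+ 2 / (gam * t) * (`|v 0 k| * sigma k) *
       (t * gam * (`|v 0 k| * sigma k)).
    by field; rewrite !gt_eqF.
  have -> : theta ^+ 2 * V / (2 * (gam * t)) * (`|v 0 k| * sigma k) *
      (2 * (count_mem k s)%:R) =
     theta ^+ 2 / (gam * t) * (`|v 0 k| * sigma k) * (V * (count_mem k s)%:R).
    by field; rewrite !gt_eqF.
  apply: ler_wpM2l lo; rewrite mulr_ge0// divr_ge0 ?sqr_ge0// ltW// mulr_gt0//.
rewrite -mulr_sumr -/V le_eqVlt; apply/orP; left; apply/eqP.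
by rewrite /theta; field; rewrite !gt_eqF.
Qed.

Let exponent_coord l b :
  exponent (Some (l, b)) <= - (gam * t * delta ^+ 2 / 2).
Proof.
have /andP[g0 g1] := gam01.
have n0 := count_gt0 l; have lo := count_lower2 l.
rewrite /exponent big_split slope_sum.
have -> : \sum_k slope (Some (l, b)) k ^+ 2 * sigma k ^+ 2 /
    (2 * (count_mem k s)%:R) =
    tau ^+ 2 * sigma l ^+ 2 / (2 * (count_mem l s)%:R).
  rewrite (bigD1 l)//= eqxx big1 ?addr0; last first.
    by move=> k /negPf ->; rewrite expr0n !mul0r.
  by rewrite exprMn sqrr_sign mulr1.
(* The exponent is at most [tau rho / 2 - tau rho + tau rho / 4 = - tau rho / 4]: [dev] bounds the
   linear part, [quad] with [tauE] the variance, and [small] compares with the target. *)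
have dev : tau * ((-1) ^+ b * (lam 0 l - eta 0 l)) <= tau * (rho / 2).
  rewrite ler_pM2l//; apply: le_trans (ler_norm _) _.
  rewrite normrM normr_sign mul1r lamE; apply: le_trans delta_small1.
  by rewrite ler_pM2l.
have quad : tau ^+ 2 * sigma l ^+ 2 / (2 * (count_mem l s)%:R) <=
    tau ^+ 2 * S ^+ 2 / (2 * (t * beta)).
  apply: ler_pM.
  - by rewrite mulr_ge0 ?sqr_ge0.
  - by rewrite invr_ge0 mulr_ge0.
  - rewrite ler_pM2l ?exprn_gt0// ler_sqr ?nnegrE//.
    + exact: ltW.
    + exact: ltW.
  - by rewrite lef_pV2 ?posrE ?mulr_gt0// ler_pM2l.
have tauE : tau ^+ 2 * S ^+ 2 / (2 * (t * beta)) = tau * (rho / 4).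
  by rewrite /tau; field; rewrite !gt_eqF.
have small : gam * t * delta ^+ 2 / 2 <= tau * (rho / 4).
  have -> : tau * (rho / 4) = t / (8 * S ^+ 2) * (rho ^+ 2 * beta).
    by rewrite /tau; field; rewrite gt_eqF.
  apply: (@le_trans _ _ (t / (8 * S ^+ 2) * (2 * S * delta) ^+ 2)).
    have -> : t / (8 * S ^+ 2) * (2 * S * delta) ^+ 2 = 1 * (t * delta ^+ 2 / 2).
      by field; rewrite gt_eqF.
    rewrite -2!(mulrA gam); apply: ler_wpM2r; last exact: ltW.
    by rewrite divr_ge0// mulr_ge0 ?sqr_ge0 ?(ltW t_gt0).
  by apply: ler_wpM2l => //; rewrite divr_ge0 ?(ltW t_gt0)// mulr_ge0// sqr_ge0.
by move: dev quad; rewrite tauE /=; lra.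
Qed.

(** The union bound has [1 + 2 * K] terms with a common bound; their number becomes the logarithm in
    the exponent. *)
Lemma half_ball_error :
  (error_prob P sigma istar lam
     (schedule_algorithm Omega (size s) k0 s istar_borel) <=
   (expR (- (gam * (size s)%:R * delta ^+ 2 / 2 - ln (1 + 2 * K%:R))))%:E)%E.
Proof.
have cnt k : (0 < count_mem k s)%N by rewrite -(ltr0n R).
apply: (le_trans
  (schedule_error_chernoff P k0 sigma_gt0 istar_borel cnt separation)).
apply: (@le_trans _ _ (\sum_(j : option ('I_K * bool))
    (expR (- (gam * t * delta ^+ 2 / 2)))%:E)%E).
  apply: lee_sum => j _; rewrite lee_fin ler_expR.
  by case: j => [[l b]|]; [exact: exponent_coord|exact: exponent_hyperplane].
rewrite sumEFin lee_fin sumr_const card_option card_prod card_ord card_bool.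
have K1 := K_ge1; rewrite opprB expRD lnK ?posrE; last by lra.
by rewrite -[leLHS]mulr_natl ler_pM2r ?expR_gt0// -natr1 natrM; lra.
Qed.

End one_schedule.

(** One factor [gam] is the mass on the ideal proportions; the other absorbs the logarithm of the
    number of terms for large [T]. *)
Lemma static_oracle_le (e : R) : 0 < e -> gam = 1 - e -> beta = e / (2 * K%:R) ->
  (oracle_difficulty P sigma istar (static_families istar) lam <=
   (2 / (gam ^+ 2 * delta ^+ 2))%:E :> \bar R)%E.
Proof.
move=> e0 gamE betaE; have /andP[g0 g1] := gam01; have K1 := K_ge1.
pose k0 := Ordinal K_gt0.
(* Mixing with the uniform proportions makes every weight positive. *)
pose omega k := gam * (`|v 0 k| * sigma k / V) + e / K%:R.
have simplex : open_simplex omega.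
  split=> [k|]; rewrite /omega.
    rewrite ltr_wpDl ?divr_gt0 ?mulr_ge0 ?invr_ge0 ?(ltW g0) ?(ltW V_gt0)//.
      by rewrite ltW.
    by rewrite ltr0n.
  rewrite big_split/= -mulr_sumr -mulr_suml -/V divff ?gt_eqF// sumr_const.
  by rewrite card_ord -[X in _ + X]mulr_natl mulrCA divff ?gt_eqF ?ltr0n// gamE; ring.
pose s T := sval (cid2 (exists_allocation T k0 simplex)).
have sT T : size (s T) = T by rewrite /s; case: cid2.
have scount T k : `|(count_mem k (s T))%:R - T%:R * omega k| <= K%:R.
  by rewrite /s; case: cid2.
pose A : algorithm_family Omega R K I :=
  fun T => schedule_algorithm Omega T k0 (s T) istar_borel.
apply: (@le_trans _ _ (limn_esup (fun T => hardness P sigma istar lam (A T)))).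
  apply: ereal_inf_lbound; exists A => //; exists omega => // T T0 w h.
  split=> [k|]; first by rewrite schedule_num_pulls.
  by rewrite schedule_empirical_mean.
(* Rounding costs at most [K] pulls per arm. Of the uniform share [e / K = 2 * beta], half pays for
   them and [beta] remains. *)
have [T1 HT1] := nat_mul_ge K%:R beta_gt0.
have x0 : 0 < (gam - gam ^+ 2) * delta ^+ 2 / 2.
  by rewrite divr_gt0// mulr_gt0 ?exprn_gt0// expr2; nra.
have [T2 HT2] := nat_mul_ge (ln (1 + 2 * K%:R)) x0.
apply: (@limn_esup_le _ _ _ (maxn 1 (maxn T1 T2))) => T.
rewrite !geq_max => /and3P[T_gt0 /HT1 {}HT1 /HT2 {}HT2].
have T0 : (0 : R) < T%:R by rewrite ltr0n.
pose x := gam * T%:R * delta ^+ 2 / 2 - ln (1 + 2 * K%:R).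
have xge : gam ^+ 2 * T%:R * delta ^+ 2 / 2 <= x by rewrite /x; lra.
have y0 : 0 < gam ^+ 2 * T%:R * delta ^+ 2 / 2.
  by rewrite divr_gt0// !mulr_gt0 ?exprn_gt0.
apply: (@le_trans _ _ (T%:R / x)%:E).
  apply: hardness_le; first exact: lt_le_trans xge.
  have := @half_ball_error (s T) k0; rewrite sT; apply => // k.
  have := scount T k; rewrite ler_norml /omega => /andP[lo _].
  have eK : e / K%:R = beta + beta.
    by rewrite betaE; field; rewrite gt_eqF// ltr0n.
  move: lo HT1; rewrite eK; move: (gam * _) => a; lra.
rewrite lee_fin; apply: (@le_trans _ _ (T%:R / (gam ^+ 2 * T%:R * delta ^+ 2 / 2))).
  by rewrite ler_pM2l// lef_pV2 ?posrE// (lt_le_trans y0).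
by rewrite le_eqVlt; apply/orP; left; apply/eqP; field; rewrite !gt_eqF.
Qed.

End half_ball.

(** * Confronting the two bounds *)

Lemma oracle_difficulty_ge0 (R : realType) (K : nat) (I : finType) d
    (Omega : measurableType d) (P : probability Omega R) (sigma : 'I_K -> R)
    (istar : 'rV[R]_K -> I) (C : set (algorithm_family Omega R K I)) mu :
  (0 <= oracle_difficulty P sigma istar C mu)%E.
Proof.
apply: le_ereal_inf_tmp => _ [A _ <-]; rewrite leNgt; apply/negP.
move=> /limn_esup_lt[T0 /(_ T0 (leqnn _))]; apply/negP.
by rewrite -leNgt hardness_ge0.
Qed.

(** The form [1 - 4 * e] anticipates the ratio [(1 - e) ^ 2 / (1 + 2 * e)] between the two bounds,
    which is at least that large. *)
Lemma lt1_margin (R : realType) (x : \bar R) : (x < 1)%E ->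
  exists e : R, [/\ 0 < e, e < 1 & (x < (1 - 4 * e)%:E)%E].
Proof.
case: x => [x| |] x1 //; last by exists 2^-1; split; [lra|lra|exact: ltNyr].
rewrite lte_fin in x1; have y0 : 0 < (1 - x) / 5 by lra.
pose m : R := Num.min 5^-1 ((1 - x) / 5).
have m0 : 0 < m by rewrite lt_min y0 andbT; lra.
have m1 : m <= 5^-1 by rewrite ge_min lexx.
have m2 : m <= (1 - x) / 5 by rewrite ge_min lexx orbT.
by exists m; split => //; rewrite ?lte_fin; lra.
Qed.

Theorem theorem7 (R : realType) (d : measure_display) (Omega : measurableType d)
    (P : probability Omega R) (K : nat) (hK : (0 < K)%N)
    (sigma : 'I_K -> R) (hsigma : forall k, 0 < sigma k)
    (I : finType) (D : set 'rV[R]_K) (istar : 'rV[R]_K -> I)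
    (htask : is_identification_task D istar)
    (eta : 'rV[R]_K) (heta : closure D eta) (r : R) (hr : 0 < r)
    (i j : I) (hij : i != j)
    (hball : two_answers_hyperplane D istar eta r i j) :
  (1 <= ereal_inf
    [set ereal_sup
      [set difficulty_ratio P sigma istar
             (oracle_difficulty P sigma istar (static_families istar)) A lambda
      | lambda in D]
    | A in @all_families d Omega R K I])%E.
Proof.
apply: le_ereal_inf_tmp => _ [A _ <-]; rewrite leNgt; apply/negP.
move=> /lt1_margin[e [e0 e1 sup_lt]].
have [_ [v v0 [celli cellj]]] := hball.
have K1 : 1 <= K%:R :> R by rewrite ler1n.
pose gam := 1 - e; pose rho := r / (2 * K%:R); pose beta := e / (2 * K%:R).
pose S := \sum_k sigma k.
have S0 : 0 < S.
  rewrite /S (bigD1 (Ordinal hK))//= ltr_pwDl// sumr_ge0// => k _.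
  exact: ltW.
have KK0 : 0 < 2 * K%:R :> R by lra.
have rho0 : 0 < rho by rewrite divr_gt0.
have beta0 : 0 < beta by rewrite divr_gt0.
have beta1 : beta <= 1 by rewrite ler_pdivrMr// mul1r; lra.
(* Then [delta * S = rho / 2 * beta] and [2 * S * delta = rho * beta], so both smallness conditions
   follow from [beta <= 1]. *)
pose delta := rho * beta / (2 * S).
have delta0 : 0 < delta by rewrite /delta divr_gt0// mulr_gt0.
have gam01 : 0 < gam < 1 by rewrite /gam; apply/andP; split; lra.
have small1 : delta * S <= rho / 2.
  have -> : delta * S = rho / 2 * beta by rewrite /delta; field; rewrite gt_eqF.
  by rewrite ler_piMr// divr_ge0// ltW.
have small2 : (2 * S * delta) ^+ 2 <= rho ^+ 2 * beta.
  have -> : 2 * S * delta = rho * beta by rewrite /delta; field; rewrite gt_eqF.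
  by rewrite exprMn ler_pM2l ?exprn_gt0// expr2 ler_piMr// ltW.
(* The sign is [1] where [v] vanishes, so that every coordinate, even there, moves by exactly
   [delta * sigma k]. *)
pose sg k : R := if 0 <= v 0 k then 1 else -1.
have sgv k : v 0 k * sg k = `|v 0 k|.
  rewrite /sg; case: ifPn => h; first by rewrite mulr1 ger0_norm.
  by rewrite mulrN1 ltr0_norm// ltNge.
have sg1 k : `|sg k| = 1 by rewrite /sg; case: ifP; rewrite ?normrN normr1.
pose lam (b : bool) : 'rV[R]_K :=
  \row_k (eta 0 k + (-1) ^+ b * (delta * sigma k * sg k)).
have lam_sub b k : lam b 0 k - eta 0 k = (-1) ^+ b * (delta * sigma k * sg k).
  by rewrite mxE addrC addKr.
have lam_norm b k : `|lam b 0 k - eta 0 k| = delta * sigma k.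
  by rewrite lam_sub normrM normr_sign mul1r normrM sg1 mulr1 gtr0_norm// mulr_gt0.
(* The normal vector oriented towards [lam b]: both problems become instances of the same half-ball
   situation. *)
pose w (b : bool) : 'rV[R]_K := (-1) ^+ b *: v.
have lam_dir b : \sum_k w b 0 k * (lam b 0 k - eta 0 k) =
    delta * \sum_k `|w b 0 k| * sigma k.
  rewrite mulr_sumr; apply: eq_bigr => k _; rewrite lam_sub mxE.
  rewrite normrM normr_sign mul1r -sgv mulrACA -expr2 sqrr_sign; ring.
have w0 b : w b != 0 by rewrite scaler_eq0 signr_eq0.
pose ans (b : bool) := if b then i else j.
have half b x : l2ball eta r x -> 0 < \sum_k w b 0 k * (x 0 k - eta 0 k) ->
    answer_cell D istar (ans b) x.
  have -> : \sum_k w b 0 k * (x 0 k - eta 0 k) =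
      (-1) ^+ b * \sum_k v 0 k * (x 0 k - eta 0 k).
    by rewrite mulr_sumr; apply: eq_bigr => k _; rewrite mxE mulrA.
  move=> xball; case: b => /=.
    rewrite expr1 mulN1r oppr_gt0 => xneg.
    have : (l2ball eta r `&` answer_cell D istar i) x by rewrite celli.
    by case.
  rewrite expr0 mul1r => xpos.
  have : (l2ball eta r `&` answer_cell D istar j) x by rewrite cellj.
  by case.
have half_star b x : l2ball eta r x ->
    0 < \sum_k w b 0 k * (x 0 k - eta 0 k) -> istar x = ans b.
  by move=> xb xp; have [] := half b x xb xp.
have lam_ball b : l2ball eta r (lam b).
  exact: (half_ball_lam hK hsigma hr delta0 (lam_norm b) small1).
have lam_pos b : 0 < \sum_k w b 0 k * (lam b 0 k - eta 0 k).
  rewrite lam_dir mulr_gt0//.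
  have [k wk] : exists k, w b 0 k != 0.
    apply/existsP; apply: contraNT (w0 b) => /existsPn z; apply/eqP/rowP => k.
    by rewrite [RHS]mxE; apply/eqP; have := z k; rewrite negbK.
  rewrite (bigD1 k)//= ltr_pwDl ?mulr_gt0 ?normr_gt0//.
  by apply: sumr_ge0 => l _; rewrite mulr_ge0// ltW.
have star b : istar (lam b) = ans b by apply: half_star.
have Dlam b : D (lam b) by have [] := half b _ (lam_ball b) (lam_pos b).
pose H mu := oracle_difficulty P sigma istar
  (@static_families _ Omega R K I istar) mu.
pose M := 2 / (gam ^+ 2 * delta ^+ 2).
have oracle b : (H (lam b) <= M%:E)%E.
  apply: (static_oracle_le P hK hsigma (istar_borel htask) hr (w0 b)
    (half_star b) delta0 (lam_norm b) (lam_dir b) gam01 beta0 small1 small2 e0) => //.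
have ratio_lt b : exists T0, forall T, (T0 <= T)%N ->
    (hardness P sigma istar (lam b) (A T) / H (lam b) < (1 - 4 * e)%:E)%E.
  apply: limn_esup_lt; apply: le_lt_trans sup_lt.
  by apply: ereal_sup_ubound; exists (lam b).
have [T1 HT1] := ratio_lt true; have [T2 HT2] := ratio_lt false.
(* With [n >= 1 / e], Hoelder's exponent inflates the information by [n.+1 / n <= 1 + e] only. *)
have [n1 /(_ (maxn 1 n1))] := nat_mul_ge 1 e0.
rewrite leq_max leqnn orbT => /(_ isT).
have : (0 < maxn 1 n1)%N by rewrite leq_max.
move: (maxn 1 n1) => n n0 ne; have nn0 : (0 : R) < n%:R by rewrite ltr0n.
have qe : n.+1%:R / n%:R <= 1 + e.
  by rewrite ler_pdivrMr// -natr1; lra.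
have ed0 : 0 < e * delta ^+ 2 / 2 by rewrite divr_gt0// mulr_gt0// exprn_gt0.
(* From [T3] on, the constant [n.+1 * ln 2] costs at most another [e] in the factor of
   [T delta ^ 2 / 2]. *)
have [T3 HT3] := nat_mul_ge (n.+1%:R * ln 2) ed0.
pose T := maxn 1 (maxn T1 (maxn T2 T3)).
have T_gt0 : (0 : R) < T%:R by rewrite ltr0n leq_max.
have /HT1 {}HT1 : (T1 <= T)%N by rewrite !leq_max leqnn orbT.
have /HT2 {}HT2 : (T2 <= T)%N by rewrite !leq_max leqnn !orbT.
have /HT3 {}HT3 : (T3 <= T)%N by rewrite !leq_max leqnn !orbT.
pose x := n.+1%:R / n%:R * delta ^+ 2 / 2 * T%:R + n.+1%:R * ln 2.
have c0 : 0 < T%:R * delta ^+ 2 / 2 by rewrite divr_gt0// mulr_gt0// exprn_gt0.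
have xle : x <= (1 + 2 * e) * (T%:R * delta ^+ 2 / 2).
  have := ler_wpM2r (ltW c0) qe; rewrite /x; move: (n.+1%:R / n%:R) => q; lra.
have x0 : 0 < x.
  rewrite /x ltr_pwDl//; last by rewrite mulr_ge0// ln_ge0// ler1n.
  by rewrite mulr_gt0// divr_gt0// mulr_gt0 ?exprn_gt0// divr_gt0.
have ratio_ge b : ((expR (- x))%:E <= error_prob P sigma istar (lam b) (A T))%E ->
    ((1 - 4 * e)%:E <=
     hardness P sigma istar (lam b) (A T) / H (lam b))%E.
  move=> /(hardness_ge x0) hge.
  have M0 : 0 < M by rewrite divr_gt0// mulr_gt0 ?exprn_gt0//; case/andP: gam01.
  apply: (@le_trans _ _ ((T%:R / x)%:E * M%:E^-1)%E); last first.
    apply: lee_pmul => //.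
    - by rewrite lee_fin divr_ge0 ?ltW.
    - by rewrite inve_ge0 lee_fin ltW.
    - rewrite lee_pV2 ?inE ?oracle_difficulty_ge0 ?lee_fin ?(ltW M0)//.
  rewrite inver gt_eqF// -EFinM lee_fin.
  apply: (@le_trans _ _ (T%:R / ((1 + 2 * e) * (T%:R * delta ^+ 2 / 2)) / M)).
    have -> : T%:R / ((1 + 2 * e) * (T%:R * delta ^+ 2 / 2)) / M =
        gam ^+ 2 / (1 + 2 * e).
      rewrite /M; field; rewrite !gt_eqF//; last by lra.
      by case/andP: gam01.
    (* This is [(1 - 4 e) (1 + 2 e) <= (1 - e) ^ 2]. *)
    by rewrite ler_pdivlMr; [rewrite /gam; nra|lra].
  rewrite ler_pM2r ?invr_gt0// ler_pM2l// lef_pV2 ?posrE// mulr_gt0//; lra.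
have gap b k : (eta 0 k - lam b 0 k) ^+ 2 = (delta * sigma k) ^+ 2.
  by rewrite -(lam_norm b) real_normK ?num_real// -sqrrN opprB.
have ans_neq : istar (lam true) != istar (lam false) by rewrite !star.
(* Which of the two problems has the large error depends on [A T]; either one contradicts the
   assumed margin at this horizon. *)
have [/ratio_ge|/ratio_ge] := error_prob_lower P (A T) hsigma n0 ans_neq
  (gap true) (gap false).
  by rewrite leNgt HT1.
by rewrite leNgt HT2.
Qed.
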